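(* Let $a>0$ with $a\neq 1$, and let $\sigma(a)$ denote the supremum of all real $\sigma$ such that $\zeta(\sigma+it)=a$ for some $t\in\mathbb{R}$. If $a>1$, then the equation $\zeta(\sigma)=a$ has a unique solution $\sigma>1$, and $\sigma(a)$ equals this solution. If $0<a<1$, then the equation $\frac{\zeta(2\sigma)}{\zeta(\sigma)}=a$ has a unique solution $\sigma>1$, and $\sigma(a)$ equals this solution.
   Context: $\zeta$ denotes the Riemann zeta function. *)

(* Defs.v *)
From Stdlib Require Import Reals ClassicalEpsilon.
From Coquelicot Require Import Coquelicot.

Open Scope R_scope.

Definition Cexp (z : C) : C :=
  (exp (Re z) * cos (Im z), exp (Re z) * sin (Im z)).

(* (n+1)^{-s}; the shift makes [zeta_term s 0] the term 1^{-s}. *)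
Definition zeta_term (s : C) (n : nat) : C :=
  Cexp (- s * RtoC (ln (INR (S n))))%C.

Definition zeta_series (s : C) : C :=
  (Series (fun n => Re (zeta_term s n)), Series (fun n => Im (zeta_term s n))).

(* The value of Z at the pole 1 is unconstrained; everywhere else Z is
   determined, by the identity theorem. *)
Definition is_zeta_continuation (Z : C -> C) : Prop :=
  (forall s : C, 1 < Re s -> Z s = zeta_series s) /\
  (forall s : C, s <> RtoC 1 -> @ex_derive C_AbsRing C_NormedModule Z s).

Definition zeta_continuation : C -> C :=
  epsilon (inhabits zeta_series) is_zeta_continuation.

(* A choice of [zeta_continuation] agrees with the series on Re s > 1, so the
   case split does not change the function; it only lets its values there be
   used without first establishing that the continuation exists. *)
Definition zeta (s : C) : C :=
  if Rlt_dec 1 (Re s) then zeta_series s else zeta_continuation s.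

(* s = 1 is excluded because zeta has a pole there, and [zeta (RtoC 1)] is
   a meaningless value. *)
Definition attains_at_abscissa (a sigma : R) : Prop :=
  exists t : R,
    let s := (RtoC sigma + Ci * RtoC t)%C in
    s <> RtoC 1 /\ zeta s = RtoC a.

Definition sigma_sup (a : R) : Rbar := Lub_Rbar (attains_at_abscissa a).

(* Main.v *)
Require Import Defs.
From Stdlib Require Import Reals Lra Lia Bool Wf_nat Classical Ranalysis5.
From mathcomp Require ssreflect ssrbool ssrnat eqtype fintype bigop div prime.
From Coquelicot Require Import Coquelicot.

(** On [Re s = x > 1] the triangle inequality gives [|zeta s| <= zeta x], and the
    Euler product gives [|zeta s| >= prod_p 1 / (1 + p^{-x}) = zeta (2 x) / zeta x],
    the Dirichlet series [L x] of the Liouville function. Both real bounds are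
    strictly monotone in [x], so no value [a] is taken to the right of the claimed
    abscissa. The first bound is attained at [t = 0]. For the second one, let
    [L x0 = a]. By Kronecker's theorem for the numbers [ln p] there are [t] with
    [p^{-it}] close to [-1] for all small primes, so that [s |-> zeta (s + i t)] is
    close to [L], together with its difference quotients, near [x0]. Since
    [L' x0 > 0], Newton's map for [zeta (s + i t) = a] is a contraction near [x0],
    and its fixed point is a solution whose real part is close to [x0]. *)

Open Scope R_scope.

(** For [a < 1] the supremum is not attained: equality in the lower bound for [|zeta s|] would force
    [p^{-it} = -1] for every prime, hence a power of 2 equal to a power of 3. Solutions can
    therefore only be produced at abscissas approaching the supremum. Having a value of zeta near
    [a] does not yet give a solution; the contraction also needs the difference between the
    translate of zeta and [L] to have a small Lipschitz constant. Both quantities are bounded by one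
    weighted sum of [|n^{-it} - liouville n|], with weights [n^{-x} (1 + ln n)], and this sum is
    what Kronecker's theorem makes small. The independence of the [ln p] is used as unique
    factorization: a product of Fejer kernels in the phases expands into cosines of frequencies
    [ln m - ln n], and those with [m <> n] have mean 0. The series for [L'] has terms of both signs,
    so its positivity is read off the Euler product: the factor at 2 forces [L] to grow at a linear
    rate, which a second-order expansion transfers to [L']. Euler products appear only as finite
    products whose multiple by the sum tends to 1. *)

Module Arithmetic.
Import ssreflect ssrbool ssrnat eqtype fintype bigop div prime.
Local Open Scope nat_scope.

(** * Primes, divisibility and the Liouville function *)

Definition isprime (p : nat) : bool := prime p.
Definition divides (d n : nat) : bool := d %| n.

Lemma isprime_ge2 p : isprime p = true -> (2 <= p)%coq_nat.
Proof. by move=> /prime_gt1 /leP. Qed.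

Lemma divides_mul d m : divides d (Nat.mul d m) = true.
Proof. exact: dvdn_mulr. Qed.

Lemma dividesE d n : divides d n = true -> exists m, n = Nat.mul d m.
Proof. by move=> /dvdnP[m ->]; exists m; rewrite mulnC. Qed.

Lemma divides_prime_mul p m n : isprime p = true ->
  divides p (Nat.mul m n) = divides p m || divides p n.
Proof. exact: Euclid_dvdM. Qed.

Lemma divides_prime_pow p q j : isprime p = true -> isprime q = true ->
  divides q (Nat.pow p j) = true -> q = p.
Proof.
move=> pp pq; elim: j => [|j IH] /=.
  by rewrite /divides dvdn1 => /eqP q1; move: pq; rewrite q1.
rewrite divides_prime_mul // => /orP[|]; last exact: IH.
by rewrite /divides dvdn_prime2 // => /eqP.
Qed.

Lemma isprime_divides p q : isprime p = true -> isprime q = true ->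
  divides q p = true -> q = p.
Proof. by move=> pp pq; rewrite /divides dvdn_prime2 // => /eqP. Qed.

Lemma divides_le d n : (0 < n)%coq_nat -> divides d n = true -> (d <= n)%coq_nat.
Proof. by move=> /ltP n0 /(dvdn_leq n0) /leP. Qed.

Lemma prime_divisor n : (2 <= n)%coq_nat ->
  exists p m, [/\ isprime p = true, n = Nat.mul p m, (0 < m)%coq_nat
    & (m < n)%coq_nat].
Proof.
move=> /leP n2; have pp := pdiv_prime n2.
have n0 : 0 < n by exact: ltnW.
exists (pdiv n), (n %/ pdiv n); split=> //.
- by rewrite [Nat.mul _ _]mulnC divnK // pdiv_dvd.
- by apply/ltP; rewrite divn_gt0 ?prime_gt0 // pdiv_leq.
- by apply/ltP; rewrite ltn_Pdiv // prime_gt1.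
Qed.

(** The number of prime factors with multiplicity: [logn p n] is 0 for non-prime [p], so the sum may
    run over all [p <= n]. *)
Definition bigOmega (n : nat) : nat := \sum_(p < n.+1) logn p n.

(** No [p > n] contributes to the sum; the common range it allows makes additivity a termwise
    statement. *)
Lemma bigOmega_widen n N : 0 < n -> n <= N -> bigOmega n = \sum_(p < N.+1) logn p n.
Proof.
move=> n0 nN; rewrite /bigOmega (big_ord_widen N.+1 (fun p => logn p n)) //.
rewrite big_mkcond; apply: eq_bigr => i _; case: ifP => // /negbT.
by rewrite -leqNgt => ni; rewrite ltn_log0.
Qed.

Lemma bigOmegaM m n : 0 < m -> 0 < n ->
  bigOmega (m * n) = bigOmega m + bigOmega n.
Proof.
move=> m0 n0; rewrite (@bigOmega_widen m (m * n)) ?leq_pmulr //.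
rewrite (@bigOmega_widen n (m * n)) ?leq_pmull // -big_split /=.
by apply: eq_bigr => i _; rewrite lognM.
Qed.

Lemma bigOmega_prime p : prime p -> bigOmega p = 1.
Proof.
move=> pp; rewrite /bigOmega (bigD1 (Ordinal (ltnSn p))) //= logn_prime // eqxx.
rewrite big1 // => i; rewrite logn_prime // -val_eqE /= => /negbTE.
by rewrite eq_sym => ->.
Qed.

(** The value 0 at 0 makes the function completely multiplicative on all of [nat]. *)
Definition liouville (n : nat) : R :=
  if n is 0 then 0%R else pow (-1)%R (bigOmega n).

Lemma liouville_mul m n :
  liouville (Nat.mul m n) = Rmult (liouville m) (liouville n).
Proof.
case: m => [|m]; first by rewrite /= Rmult_0_l.
case: n => [|n]; first by rewrite Nat.mul_0_r /= Rmult_0_r.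
have -> : Nat.mul m.+1 n.+1 = (m.+1 * n.+1) by [].
rewrite {1}/liouville; case E: (m.+1 * n.+1) => [|k] //; rewrite -E.
by rewrite bigOmegaM // pow_add.
Qed.

Lemma liouville1 : liouville 1 = 1%R.
Proof. by rewrite /liouville /bigOmega big1 ?pow_O // => i _; rewrite logn1. Qed.

Lemma liouville_prime p : isprime p = true -> liouville p = (-1)%R.
Proof.
move=> pp; have := bigOmega_prime _ pp; have := prime_gt0 pp.
by case: p pp => // p _ _; rewrite /liouville => ->; rewrite pow_1.
Qed.

Lemma Rabs_liouville_le n : Rle (Rabs (liouville n)) 1.
Proof.
case: n => [|n]; first by rewrite /= Rabs_R0; lra.
by rewrite /liouville pow_1_abs; lra.
Qed.

End Arithmetic.
Import Arithmetic.

(** * Absolutely convergent complex series *)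

Definition CSeries (u : nat -> C) : C :=
  (Series (fun n => Re (u n)), Series (fun n => Im (u n))).

Definition abs_summable (u : nat -> C) : Prop := ex_series (fun n => Cmod (u n)).

Lemma Im_le_Cmod (c : C) : Rabs (Im c) <= Cmod c.
Proof.
  eapply Rle_trans; [ | apply Rmax_Cmod ]. apply Rmax_r.
Qed.

Lemma Cmod_eq (x y : R) : Cmod (x, y) = sqrt (x ^ 2 + y ^ 2).
Proof. reflexivity. Qed.

Lemma ex_series_le_abs (a b : nat -> R) :
  (forall n, Rabs (a n) <= b n) -> ex_series b -> ex_series a.
Proof. intros H Hb. apply (@ex_series_le R_AbsRing R_CompleteNormedModule a b); assumption. Qed.

Lemma abs_summable_Re u : abs_summable u -> ex_series (fun n => Re (u n)).
Proof. apply ex_series_le_abs. intro n. apply re_le_Cmod. Qed.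

Lemma abs_summable_Im u : abs_summable u -> ex_series (fun n => Im (u n)).
Proof. apply ex_series_le_abs. intro n. apply Im_le_Cmod. Qed.

Lemma abs_summable_le u b :
  (forall n, Cmod (u n) <= b n) -> ex_series b -> abs_summable u.
Proof.
  intros H. apply ex_series_le_abs. intro n.
  rewrite Rabs_pos_eq; [ apply H | apply Cmod_ge_0 ].
Qed.

Lemma CSeries_ext u v : (forall n, u n = v n) -> CSeries u = CSeries v.
Proof.
  intros H. unfold CSeries.
  f_equal; apply Series_ext; intro n; rewrite H; reflexivity.
Qed.

Lemma CSeries_minus u v : abs_summable u -> abs_summable v ->
  CSeries (fun n => (u n - v n)%C) = (CSeries u - CSeries v)%C.
Proof.
  intros Hu Hv. unfold CSeries, Cminus, Cplus, Copp; simpl.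
  f_equal.
  - rewrite <- Series_opp, <- Series_plus.
    + reflexivity.
    + apply abs_summable_Re, Hu.
    + apply (ex_series_opp (fun n => Re (v n))), abs_summable_Re, Hv.
  - rewrite <- Series_opp, <- Series_plus.
    + reflexivity.
    + apply abs_summable_Im, Hu.
    + apply (ex_series_opp (fun n => Im (v n))), abs_summable_Im, Hv.
Qed.

Lemma CSeries_scal c u : abs_summable u ->
  CSeries (fun n => (c * u n)%C) = (c * CSeries u)%C.
Proof.
  intros Hu. pose proof (abs_summable_Re u Hu) as HR.
  pose proof (abs_summable_Im u Hu) as HI.
  unfold CSeries, Cmult; simpl. f_equal.
  - rewrite <- !Series_scal_l, <- Series_minus.
    + reflexivity.
    + apply (ex_series_scal_l (fst c)) in HR. exact HR.
    + apply (ex_series_scal_l (snd c)) in HI. exact HI.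
  - rewrite <- !Series_scal_l, <- Series_plus.
    + reflexivity.
    + apply (ex_series_scal_l (fst c)) in HI. exact HI.
    + apply (ex_series_scal_l (snd c)) in HR. exact HR.
Qed.

Lemma CSeries_RtoC (v : nat -> R) : CSeries (fun n => RtoC (v n)) = RtoC (Series v).
Proof.
  unfold CSeries, RtoC; simpl. f_equal.
  rewrite (Series_ext _ (fun n => 0 * v n)) by (intro; ring).
  rewrite Series_scal_l; ring.
Qed.

Lemma dot_le_Cmod (c d : C) : Re c * Re d + Im c * Im d <= Cmod c * Cmod d.
Proof.
  replace (Re c * Re d + Im c * Im d) with (Re (Cconj c * d)%C)
    by (unfold Re, Im; simpl; ring).
  eapply Rle_trans; [ apply Rle_abs | ].
  eapply Rle_trans; [ apply re_le_Cmod | ].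
  rewrite Cmod_mult, Cmod_conj. lra.
Qed.

Lemma Series_le_abs (a b : nat -> R) :
  ex_series a -> ex_series b -> (forall n, a n <= b n) -> Series a <= Series b.
Proof.
  intros Ha Hb H.
  enough (0 <= Series b - Series a) by lra.
  rewrite <- Series_minus by assumption.
  rewrite <- (Rmult_0_l (Series (fun n => b n - a n))), <- Series_scal_l.
  apply Series_le.
  - intro n. specialize (H n). lra.
  - apply (ex_series_minus b a); assumption.
Qed.

(** Ends the duality arguments, in which a vector is paired with itself and its norm [m] may
    vanish. *)
Lemma le_of_sq_le_mul (m x : R) : 0 <= m -> 0 <= x -> m * m <= m * x -> m <= x.
Proof.
  intros Hm Hx H. destruct (Req_dec m 0) as [-> | Hne]; [ assumption | ].
  apply Rmult_le_reg_l with m; lra.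
Qed.

(* Pairing with the direction of the sum reduces the bound to the real case. *)
Lemma Cmod_CSeries_le u b : (forall n, Cmod (u n) <= b n) -> ex_series b ->
  Cmod (CSeries u) <= Series b.
Proof.
  intros H Hb. pose proof (abs_summable_le u b H Hb) as Hu.
  pose proof (abs_summable_Re u Hu) as HR. pose proof (abs_summable_Im u Hu) as HI.
  set (c := CSeries u).
  assert (Hb0 : 0 <= Series b).
  { rewrite <- (Rmult_0_l (Series b)), <- Series_scal_l. apply Series_le; [ | exact Hb ].
    intro n. pose proof (Cmod_ge_0 (u n)). specialize (H n). lra. }
  apply le_of_sq_le_mul; [ apply Cmod_ge_0 | exact Hb0 | ].
  assert (E : Cmod c * Cmod c = Re c * Re c + Im c * Im c).
  { replace (Cmod c * Cmod c) with (Cmod c ^ 2) by ring. rewrite Cmod2_alt. ring. }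
  rewrite E.
  change (Re c * Series (fun n => Re (u n)) + Im c * Series (fun n => Im (u n))
    <= Cmod c * Series b).
  clearbody c. rewrite <- !Series_scal_l, <- Series_plus.
  - apply Series_le_abs.
    + apply (ex_series_plus (fun n => Re c * Re (u n)) (fun n => Im c * Im (u n))).
      * apply (ex_series_scal_l (Re c)) in HR. exact HR.
      * apply (ex_series_scal_l (Im c)) in HI. exact HI.
    + apply (ex_series_scal_l (Cmod c)) in Hb. exact Hb.
    + intro n. eapply Rle_trans; [ apply dot_le_Cmod | ].
      apply Rmult_le_compat_l; [ apply Cmod_ge_0 | apply H ].
  - apply (ex_series_scal_l (Re c)) in HR. exact HR.
  - apply (ex_series_scal_l (Im c)) in HI. exact HI.
Qed.

(** * Estimates for the complex exponential *)

(** The mean value theorem fails for complex-valued functions, so it is applied to the scalar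
    projection of the curve onto its own chord [(A, B)]. *)
Lemma Cmod_sub_le_of_derive (p q p' q' : R -> R) (M : R) :
  (forall x, 0 <= x <= 1 -> is_derive p x (p' x)) ->
  (forall x, 0 <= x <= 1 -> is_derive q x (q' x)) ->
  (forall x, 0 <= x <= 1 -> Cmod (p' x, q' x) <= M) ->
  Cmod (p 1 - p 0, q 1 - q 0) <= M.
Proof.
  intros Hp Hq HM.
  set (A := p 1 - p 0). set (B := q 1 - q 0).
  assert (HM0 : 0 <= M).
  { eapply Rle_trans; [ apply Cmod_ge_0 | apply (HM 0); lra ]. }
  destruct (MVT_gen (fun x => A * p x + B * q x) 0 1 (fun x => A * p' x + B * q' x))
    as [xi [Hxi E]].
  - rewrite Rmin_left, Rmax_right by lra. intros x Hx.
    apply (is_derive_plus (fun x => A * p x) (fun x => B * q x)).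
    + apply is_derive_scal. apply Hp. lra.
    + apply is_derive_scal. apply Hq. lra.
  - rewrite Rmin_left, Rmax_right by lra. intros x Hx.
    apply continuity_pt_filterlim.
    apply (ex_derive_continuous (fun x => A * p x + B * q x)).
    exists (A * p' x + B * q' x).
    apply (is_derive_plus (fun x => A * p x) (fun x => B * q x)).
    + apply is_derive_scal. apply Hp. lra.
    + apply is_derive_scal. apply Hq. lra.
  - rewrite Rmin_left, Rmax_right in Hxi by lra.
    apply le_of_sq_le_mul; [ apply Cmod_ge_0 | exact HM0 | ].
    replace (Cmod (A, B) * Cmod (A, B)) with (Cmod (A, B) ^ 2) by ring.
    rewrite Cmod2_alt. simpl Re; simpl Im.
    replace (A ^ 2 + B ^ 2) with (A * p' xi + B * q' xi)
      by (unfold A, B in *; lra).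
    eapply Rle_trans; [ apply (dot_le_Cmod (A, B) (p' xi, q' xi)) | ].
    apply Rmult_le_compat_l; [ apply Cmod_ge_0 | apply HM; exact Hxi ].
Qed.

Lemma Cmod_Cexp z : Cmod (Cexp z) = exp (Re z).
Proof.
  unfold Cexp. rewrite Cmod_eq.
  replace ((exp (Re z) * cos (Im z)) ^ 2 + (exp (Re z) * sin (Im z)) ^ 2)
    with (exp (Re z) ^ 2 * (Rsqr (sin (Im z)) + Rsqr (cos (Im z)))) by (unfold Rsqr; ring).
  rewrite sin2_cos2, Rmult_1_r. apply sqrt_pow2. left; apply exp_pos.
Qed.

Lemma Cexp_plus z w : Cexp (z + w) = (Cexp z * Cexp w)%C.
Proof.
  unfold Cexp, Cmult, Re, Im. simpl. rewrite exp_plus, cos_plus, sin_plus.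
  f_equal; ring.
Qed.

Lemma Cexp_RtoC x : Cexp (RtoC x) = RtoC (exp x).
Proof.
  unfold Cexp, RtoC, Re, Im. simpl. rewrite cos_0, sin_0. f_equal; ring.
Qed.

Lemma exp_le_compat x y : x <= y -> exp x <= exp y.
Proof. intros [H | ->]; [ left; apply exp_increasing, H | lra ]. Qed.

(** Mean value inequality on the segment from [z] to [w], where the derivative has modulus at most
    [exp m]. *)
Lemma Cmod_Cexp_sub_le z w m : Re z <= m -> Re w <= m ->
  Cmod (Cexp w - Cexp z) <= exp m * Cmod (w - z).
Proof.
  intros Hz Hw.
  destruct z as [z1 z2], w as [w1 w2]; simpl in Hz, Hw.
  set (a := w1 - z1). set (b := w2 - z2).
  pose (e := fun x => exp (z1 + x * a)).
  pose (o := fun x => z2 + x * b).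
  replace (Cexp (w1, w2) - Cexp (z1, z2))%C
    with (e 1 * cos (o 1) - e 0 * cos (o 0), e 1 * sin (o 1) - e 0 * sin (o 0)).
  2:{ unfold Cexp, Cminus, Cplus, Copp, Re, Im, e, o, a, b; simpl.
      rewrite !Rmult_0_l, !Rmult_1_l, !Rplus_0_r.
      replace (z1 + (w1 - z1)) with w1 by ring. replace (z2 + (w2 - z2)) with w2 by ring.
      f_equal; ring. }
  apply (Cmod_sub_le_of_derive (fun x => e x * cos (o x)) (fun x => e x * sin (o x))
    (fun x => Re ((a, b) * Cexp ((z1 + x * a)%R, o x))%C)
    (fun x => Im ((a, b) * Cexp ((z1 + x * a)%R, o x))%C)).
  - intros x _. unfold e, o. auto_derive; [ tauto | ]. unfold Re, Im; simpl; ring.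
  - intros x _. unfold e, o. auto_derive; [ tauto | ]. unfold Re, Im; simpl; ring.
  - intros x Hx.
    change (Cmod ((a, b) * Cexp ((z1 + x * a)%R, o x)) <= exp m * Cmod (a, b)).
    rewrite Cmod_mult, Cmod_Cexp, Rmult_comm. simpl.
    apply Rmult_le_compat_r; [ apply Cmod_ge_0 | ].
    apply exp_le_compat. unfold a. nra.
Qed.

(** The same inequality once the linear part at [z0] is subtracted. The derivative along the segment
    is [w - z] times a difference of exponentials, bounded by [Cmod_Cexp_sub_le] because the disc of
    radius [r] around [z0] is convex. *)
Lemma Cmod_Cexp_linearize z0 z w m r : Re z0 <= m -> Re z <= m -> Re w <= m ->
  Cmod (z - z0) <= r -> Cmod (w - z0) <= r ->
  Cmod (Cexp w - Cexp z - (w - z) * Cexp z0) <= exp m * r * Cmod (w - z).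
Proof.
  intros H0 Hz Hw Hzr Hwr.
  destruct z as [z1 z2], w as [w1 w2]; simpl in Hz, Hw.
  set (a := w1 - z1). set (b := w2 - z2).
  pose (e := fun x => exp (z1 + x * a)).
  pose (o := fun x => z2 + x * b).
  set (c := ((a, b) * Cexp z0)%C).
  replace (Cexp (w1, w2) - Cexp (z1, z2) - ((w1, w2) - (z1, z2)) * Cexp z0)%C
    with ((e 1 * cos (o 1) - 1 * Re c) - (e 0 * cos (o 0) - 0 * Re c),
          (e 1 * sin (o 1) - 1 * Im c) - (e 0 * sin (o 0) - 0 * Im c)).
  2:{ replace ((w1, w2) - (z1, z2))%C with ((a, b) : C) by reflexivity.
      fold c. unfold Cexp, Cminus, Cplus, Copp, Re, Im, e, o, a, b; simpl.
      rewrite !Rmult_0_l, !Rmult_1_l, !Rplus_0_r.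
      replace (z1 + (w1 - z1)) with w1 by ring. replace (z2 + (w2 - z2)) with w2 by ring.
      f_equal; ring. }
  apply (Cmod_sub_le_of_derive
    (fun x => e x * cos (o x) - x * Re c) (fun x => e x * sin (o x) - x * Im c)
    (fun x => Re ((a, b) * (Cexp ((z1 + x * a)%R, o x) - Cexp z0))%C)
    (fun x => Im ((a, b) * (Cexp ((z1 + x * a)%R, o x) - Cexp z0))%C)).
  - intros x _. unfold e, o. auto_derive; [ tauto | ]. unfold c, Cexp, Re, Im. simpl; ring.
  - intros x _. unfold e, o. auto_derive; [ tauto | ]. unfold c, Cexp, Re, Im. simpl; ring.
  - intros x Hx.
    change (Cmod ((a, b) * (Cexp ((z1 + x * a)%R, o x) - Cexp z0)) <= exp m * r * Cmod (a, b)).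
    rewrite Cmod_mult, (Rmult_comm (Cmod (a, b))).
    apply Rmult_le_compat_r; [ apply Cmod_ge_0 | ].
    eapply Rle_trans; [ apply (Cmod_Cexp_sub_le z0 _ m); [ exact H0 | simpl; unfold a; nra ] | ].
    apply Rmult_le_compat_l; [ left; apply exp_pos | ].
    replace (((z1 + x * a)%R, o x) - z0)%C
      with (RtoC (1 - x)%R * ((z1, z2) - z0) + RtoC x * ((w1, w2) - z0))%C.
    2:{ destruct z0. unfold Cminus, Cplus, Cmult, Copp, RtoC, o, a, b; simpl. f_equal; ring. }
    eapply Rle_trans; [ apply Cmod_triangle | ].
    rewrite !Cmod_mult, !Cmod_R, !Rabs_pos_eq by lra.
    nra.
Qed.

(** * The terms [n^{-s}] *)

(* The junk value 0 at [n = 0] makes both functions completely multiplicative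
   on all of [nat]. *)
Definition cpow (s : C) (n : nat) : C :=
  match n with O => RtoC 0 | S _ => Cexp (- s * RtoC (ln (INR n))) end.

Definition rpow (x : R) (n : nat) : R :=
  match n with O => 0 | S _ => exp (- x * ln (INR n)) end.

Lemma rpow_ge0 x n : 0 <= rpow x n.
Proof. destruct n; [ simpl; lra | left; apply exp_pos ]. Qed.

Lemma rpow_gt0 x n : (0 < n)%nat -> 0 < rpow x n.
Proof. destruct n; [ lia | intros _; apply exp_pos ]. Qed.

Lemma rpow_1 x : rpow x 1 = 1.
Proof. unfold rpow. simpl INR. rewrite ln_1, Rmult_0_r. apply exp_0. Qed.

Lemma cpow_1 s : cpow s 1 = RtoC 1.
Proof.
  unfold cpow. simpl INR. rewrite ln_1, Cmult_0_r, Cexp_RtoC, exp_0. reflexivity.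
Qed.

Lemma Cmod_cpow s n : Cmod (cpow s n) = rpow (Re s) n.
Proof.
  destruct n; [ apply Cmod_0 | ]. unfold cpow. rewrite Cmod_Cexp.
  unfold rpow. f_equal. unfold Re; simpl. ring.
Qed.

Lemma cpow_RtoC x n : cpow (RtoC x) n = RtoC (rpow x n).
Proof.
  destruct n; [ reflexivity | ]. unfold cpow.
  rewrite <- RtoC_opp, <- RtoC_mult, Cexp_RtoC. reflexivity.
Qed.

Lemma ln_INR_mul m n : (0 < m)%nat -> (0 < n)%nat ->
  ln (INR (m * n)) = ln (INR m) + ln (INR n).
Proof. intros Hm Hn. rewrite mult_INR. apply ln_mult; apply lt_0_INR; assumption. Qed.

Lemma cpow_mul s m n : cpow s (m * n) = (cpow s m * cpow s n)%C.
Proof.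
  destruct m; [ simpl; rewrite Cmult_0_l; reflexivity | ].
  destruct n; [ rewrite Nat.mul_0_r; simpl; rewrite Cmult_0_r; reflexivity | ].
  change (S m * S n)%nat with (S (n + m * S n)). unfold cpow.
  rewrite <- Cexp_plus. change (S (n + m * S n))%nat with (S m * S n)%nat.
  rewrite ln_INR_mul by lia. rewrite RtoC_plus. f_equal. ring.
Qed.

Lemma rpow_mul x m n : rpow x (m * n) = rpow x m * rpow x n.
Proof.
  apply RtoC_inj. rewrite RtoC_mult, <- !cpow_RtoC. apply cpow_mul.
Qed.

Lemma cpow_plus s w n : cpow (s + w) n = (cpow s n * cpow w n)%C.
Proof.
  destruct n; [ simpl; rewrite Cmult_0_l; reflexivity | ]. unfold cpow.
  rewrite <- Cexp_plus. f_equal. ring.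
Qed.

Lemma rpow_plus x y n : rpow (x + y) n = rpow x n * rpow y n.
Proof.
  apply RtoC_inj. rewrite RtoC_mult, <- !cpow_RtoC, RtoC_plus. apply cpow_plus.
Qed.

Lemma ln_INR_ge0 n : 0 <= ln (INR n).
Proof.
  destruct n as [ | n ].
  (* [ln] has the default value 0 at 0. *)
  - simpl INR. unfold ln. destruct (Rlt_dec 0 0) as [ H | H ]; [ elim (Rlt_irrefl 0 H) | apply Rle_refl ].
  - rewrite <- ln_1. apply ln_le; [ lra | ]. rewrite S_INR. pose proof (pos_INR n). lra.
Qed.

Lemma rpow_le x y n : x <= y -> rpow y n <= rpow x n.
Proof.
  intros H. destruct n; [ simpl; lra | ]. apply exp_le_compat.
  pose proof (ln_INR_ge0 (S n)). nra.
Qed.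

Lemma rpow_lt1 x n : 0 < x -> (2 <= n)%nat -> rpow x n < 1.
Proof.
  intros Hx Hn. destruct n; [ lia | ]. rewrite <- exp_0. apply exp_increasing.
  assert (0 < ln (INR (S n))).
  { rewrite <- ln_1. apply ln_increasing; [ lra | ]. apply (lt_INR 1). lia. }
  nra.
Qed.

Lemma rpow_double x n : rpow (2 * x) n = rpow x n * rpow x n.
Proof. rewrite <- rpow_plus. f_equal. ring. Qed.

Lemma Re_opp_mul_RtoC s l : Re (- s * RtoC l) = - Re s * l.
Proof. unfold Re; simpl. ring. Qed.

Lemma cpow_lipschitz s s' x n : x <= Re s -> x <= Re s' ->
  Cmod (cpow s n - cpow s' n) <= ln (INR n) * rpow x n * Cmod (s - s').
Proof.
  intros Hs Hs'. destruct n.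
  - simpl cpow; simpl rpow. replace (RtoC 0 - RtoC 0)%C with (RtoC 0) by ring.
    rewrite Cmod_0. right; ring.
  - unfold cpow, rpow. set (l := ln (INR (S n))).
    assert (Hl : 0 <= l) by apply ln_INR_ge0.
    eapply Rle_trans;
      [ apply (Cmod_Cexp_sub_le _ _ (- x * l)); rewrite Re_opp_mul_RtoC; nra | ].
    replace (- s * l - - s' * l)%C with (- RtoC l * (s - s'))%C by ring.
    rewrite Cmod_mult, Cmod_opp, Cmod_R, Rabs_pos_eq by exact Hl. lra.
Qed.

(** The derivative of [n^{-s}] is [- ln n * n^{-s}], whence the plus sign. One factor [ln n] comes
    from the increment of the exponent, the other from the radius, which becomes [r ln n] in the
    exponent. *)
Lemma cpow_linearize s0 s s' x r n : x <= Re s0 -> x <= Re s -> x <= Re s' ->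
  Cmod (s - s0) <= r -> Cmod (s' - s0) <= r ->
  Cmod (cpow s n - cpow s' n + (s - s') * (RtoC (ln (INR n)) * cpow s0 n))
    <= ln (INR n) ^ 2 * rpow x n * r * Cmod (s - s').
Proof.
  intros H0 Hs Hs' Hr Hr'. destruct n.
  - simpl cpow; simpl rpow.
    replace (RtoC 0 - RtoC 0 + (s - s') * (ln (INR 0) * RtoC 0))%C with (RtoC 0) by ring.
    rewrite Cmod_0. right; ring.
  - unfold cpow, rpow. set (l := ln (INR (S n))).
    assert (Hl : 0 <= l) by apply ln_INR_ge0.
    assert (Hd : forall u v : C, Cmod (- u * l - - v * l) = l * Cmod (u - v)).
    { intros u v. replace (- u * l - - v * l)%C with (- RtoC l * (u - v))%C by ring.
      rewrite Cmod_mult, Cmod_opp, Cmod_R, Rabs_pos_eq by exact Hl. reflexivity. }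
    replace (Cexp (- s * l) - Cexp (- s' * l) + (s - s') * (l * Cexp (- s0 * l)))%C
      with (Cexp (- s * l) - Cexp (- s' * l) - (- s * l - - s' * l) * Cexp (- s0 * l))%C
      by ring.
    eapply Rle_trans;
      [ apply (Cmod_Cexp_linearize _ _ _ (- x * l) (l * r));
        rewrite ?Re_opp_mul_RtoC, ?Hd; try nra; apply Rmult_le_compat_l; assumption | ].
    rewrite Hd. right; ring.
Qed.

Lemma ln_le_sub1 x : 0 < x -> ln x <= x - 1.
Proof.
  intros Hx. pose proof (exp_ineq1_le (ln x)) as H. rewrite exp_ln in H; lra.
Qed.

Lemma rpow_1_l n : (0 < n)%nat -> rpow 1 n = / INR n.
Proof.
  intros Hn. destruct n as [ | n ]; [ lia | ]. unfold rpow.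
  replace (- (1) * ln (INR (S n))) with (- ln (INR (S n))) by ring.
  rewrite exp_Ropp, exp_ln by (apply lt_0_INR; lia). reflexivity.
Qed.

(** Comparison of a term with the integral of [d u^{-1-d}], in the form
    [1 / (n + 2) <= ln (n + 2) - ln (n + 1)] together with [1 + v <= exp v]. *)
Lemma rpow_telescope d n : 0 < d ->
  d * rpow (1 + d) (S (S n)) <= rpow d (S n) - rpow d (S (S n)).
Proof.
  intros Hd. rewrite rpow_plus.
  assert (Hn : 0 < INR (S n)) by (apply lt_0_INR; lia).
  assert (Hn' : 0 < INR (S (S n))) by (apply lt_0_INR; lia).
  pose proof (rpow_1_l (S (S n)) ltac:(lia)) as E1.
  assert (E2 : rpow d (S n) = rpow d (S (S n)) * exp (d * (ln (INR (S (S n))) - ln (INR (S n))))).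
  { unfold rpow. rewrite <- exp_plus. f_equal. ring. }
  assert (H : / INR (S (S n)) <= ln (INR (S (S n))) - ln (INR (S n))).
  { pose proof (ln_le_sub1 (INR (S n) / INR (S (S n)))) as H.
    rewrite ln_div in H by assumption.
    assert (H' : INR (S n) / INR (S (S n)) - 1 = - / INR (S (S n))).
    { rewrite (S_INR (S n)) in Hn' |- *. field. lra. }
    assert (0 < INR (S n) / INR (S (S n))) by (apply Rdiv_lt_0_compat; assumption).
    specialize (H H0). lra. }
  rewrite E1, E2.
  pose proof (exp_ineq1_le (d * (ln (INR (S (S n))) - ln (INR (S n))))) as He.
  pose proof (rpow_gt0 d (S (S n)) ltac:(lia)) as Hp.
  assert (d * / INR (S (S n)) <= exp (d * (ln (INR (S (S n))) - ln (INR (S n)))) - 1) by nra.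
  nra.
Qed.

Lemma ex_series_nonneg_bounded (a : nat -> R) (M : R) :
  (forall n, 0 <= a n) -> (forall n, sum_n a n <= M) -> ex_series a.
Proof.
  intros Ha HM.
  assert (H : ex_finite_lim_seq (sum_n a)).
  { apply ex_finite_lim_seq_incr with M; [ | exact HM ].
    intro n. rewrite sum_Sn. unfold plus; simpl. specialize (Ha (S n)). lra. }
  destruct H as [l Hl]. exists l. exact Hl.
Qed.

Lemma ex_series_rpow x : 1 < x -> ex_series (rpow x).
Proof.
  intros Hx. apply ex_series_incr_1, ex_series_incr_1.
  set (d := x - 1). assert (Hd : 0 < d) by (unfold d; lra).
  apply ex_series_nonneg_bounded with (/ d).
  - intro n; apply rpow_ge0.
  - intro n.
    enough (d * sum_n (fun k => rpow x (S (S k))) n <= 1 - rpow d (S (S n))) as H.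
    { pose proof (rpow_ge0 d (S (S n))).
      apply Rmult_le_reg_l with d; [ exact Hd | ]. rewrite Rinv_r by lra. lra. }
    replace x with (1 + d) by (unfold d; ring).
    induction n as [ | n IH ].
    + rewrite sum_O. pose proof (rpow_telescope d 0 Hd) as H. rewrite (rpow_1 d) in H. exact H.
    + rewrite sum_Sn. change plus with Rplus. rewrite Rmult_plus_distr_l.
      pose proof (rpow_telescope d (S n) Hd) as H. lra.
Qed.

(** From [1 + v <= exp v] at [v = h ln n]: a logarithm costs an arbitrarily small power of [n]. *)
Lemma ln_INR_le_rpow h n : 0 < h -> (0 < n)%nat -> ln (INR n) <= / h * rpow (- h) n.
Proof.
  intros Hh Hn. destruct n; [ lia | ]. unfold rpow.
  pose proof (exp_ineq1_le (- - h * ln (INR (S n)))) as H.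
  apply Rmult_le_reg_l with h; [ exact Hh | ].
  rewrite <- Rmult_assoc, Rinv_r by lra. lra.
Qed.

Lemma ex_series_ln_rpow k x : 1 < x -> ex_series (fun n => ln (INR n) ^ k * rpow x n).
Proof.
  revert x. induction k as [ | k IH ]; intros x Hx.
  - apply ex_series_ext with (rpow x); [ intro n; simpl; symmetry; apply Rmult_1_l | ].
    apply ex_series_rpow, Hx.
  (* One logarithm is paid for by moving the exponent halfway towards 1, which keeps it above 1 for
     the induction. *)
  - set (h := (x - 1) / 2). assert (Hh : 0 < h) by (unfold h; lra).
    apply ex_series_le_abs
      with (fun n => / h * (ln (INR n) ^ k * rpow (x - h) n)).
    + intro n. pose proof (ln_INR_ge0 n) as Hl.
      rewrite Rabs_pos_eq by (apply Rmult_le_pos; [ apply pow_le, Hl | apply rpow_ge0 ]).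
      destruct n; [ simpl rpow; lra | ].
      replace (x - h) with (x + - h) by ring. rewrite rpow_plus, <- tech_pow_Rmult.
      pose proof (ln_INR_le_rpow h (S n) Hh ltac:(lia)) as H.
      pose proof (pow_le _ k Hl) as Hk. pose proof (rpow_ge0 x (S n)) as Hr.
      apply Rle_trans with (ln (INR (S n)) * (ln (INR (S n)) ^ k * rpow x (S n))); [ right; ring | ].
      apply Rle_trans with (/ h * rpow (- h) (S n) * (ln (INR (S n)) ^ k * rpow x (S n)));
        [ | right; ring ].
      apply Rmult_le_compat_r; [ apply Rmult_le_pos; assumption | exact H ].
    + apply (ex_series_scal_l (/ h) (fun n => ln (INR n) ^ k * rpow (x - h) n)).
      apply IH. unfold h. lra.
Qed.

(** * Euler products *)

(** [P]-rough numbers. The recursion runs in parallel with that of [cprod_primes], so that each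
    sieving step matches one factor. *)
Fixpoint rough (P n : nat) : bool :=
  match P with
  | O => true
  | S Q => rough Q n && negb (isprime Q && divides Q n)
  end.

Fixpoint cprod_primes (g : nat -> C) (P : nat) : C :=
  match P with
  | O => RtoC 1
  | S Q => if isprime Q then (cprod_primes g Q * g Q)%C else cprod_primes g Q
  end.

Fixpoint prod_primes (g : nat -> R) (P : nat) : R :=
  match P with
  | O => 1
  | S Q => if isprime Q then prod_primes g Q * g Q else prod_primes g Q
  end.

Lemma sum_n_multiples (v : nat -> R) (P : nat) : (0 < P)%nat ->
  forall N, sum_n (fun n => if divides P n then v n else 0) (P * N)
            = sum_n (fun m => v (P * m)%nat) N.
Proof.
  intros HP. set (g := fun n => if divides P n then v n else 0).
  assert (Hmul : forall m, g (P * m)%nat = v (P * m)%nat).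
  { intro m. unfold g. rewrite divides_mul. reflexivity. }
  assert (Hgap : forall N j, (j < P)%nat -> sum_n g (P * N + j) = sum_n g (P * N)).
  { intros N. induction j as [ | j IH ]; intros Hj; [ rewrite Nat.add_0_r; reflexivity | ].
    rewrite Nat.add_succ_r, sum_Sn, IH by lia.
    replace (g (S (P * N + j))) with 0; [ apply Rplus_0_r | ].
    unfold g. destruct (divides P (S (P * N + j))) eqn:E; [ | reflexivity ].
    exfalso. apply dividesE in E. destruct E as [m E].
    assert (m <= N \/ S N <= m)%nat as [Hm | Hm] by lia;
      apply (Nat.mul_le_mono_l _ _ P) in Hm; lia. }
  intro N. change (sum_n g (P * N) = sum_n (fun m => v (P * m)%nat) N).
  induction N as [ | N IH ].
  - specialize (Hmul O). rewrite Nat.mul_0_r in *. rewrite !sum_O, Nat.mul_0_r. exact Hmul.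
  - rewrite sum_Sn, <- IH, <- (Hgap N (pred P)), <- Hmul by lia.
    replace (P * S N)%nat with (S (P * N + pred P)) by lia.
    apply sum_Sn.
Qed.

(** Partial sums of the right-hand series are those of the left-hand one along the subsequence
    [P * N], since nothing is added between consecutive multiples. *)
Lemma Series_multiples (v : nat -> R) (P : nat) : (0 < P)%nat ->
  ex_series (fun n => if divides P n then v n else 0) ->
  Series (fun n => if divides P n then v n else 0) = Series (fun m => v (P * m)%nat).
Proof.
  intros HP Hex. symmetry. apply is_series_unique.
  apply Series_correct in Hex.
  change (is_lim_seq (sum_n (fun m => v (P * m)%nat))
    (Series (fun n => if divides P n then v n else 0))).
  apply is_lim_seq_ext with (fun N => sum_n (fun n => if divides P n then v n else 0) (P * N)).
  - intro N. apply sum_n_multiples, HP.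
  - apply (is_lim_seq_subseq (sum_n (fun n => if divides P n then v n else 0))
      (Series (fun n => if divides P n then v n else 0)) (fun N => (P * N)%nat)).
    + apply eventually_subseq. intro n. nia.
    + exact Hex.
Qed.

Lemma CSeries_multiples (u : nat -> C) (P : nat) : (0 < P)%nat -> abs_summable u ->
  CSeries (fun n => if divides P n then u n else RtoC 0) = CSeries (fun m => u (P * m)%nat).
Proof.
  intros HP Hu. unfold CSeries. f_equal.
  - rewrite <- (Series_multiples (fun n => Re (u n)) P HP).
    + apply Series_ext. intro n. destruct (divides P n); reflexivity.
    + apply ex_series_le_abs with (fun n => Cmod (u n)); [ | exact Hu ].
      intro n. destruct (divides P n); [ apply re_le_Cmod | ].
      rewrite Rabs_R0; apply Cmod_ge_0.
  - rewrite <- (Series_multiples (fun n => Im (u n)) P HP).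
    + apply Series_ext. intro n. destruct (divides P n); reflexivity.
    + apply ex_series_le_abs with (fun n => Cmod (u n)); [ | exact Hu ].
      intro n. destruct (divides P n); [ apply Im_le_Cmod | ].
      rewrite Rabs_R0; apply Cmod_ge_0.
Qed.

(** [rough Q] tests only primes below [Q <= P]; none of them divides the prime [P], so Euclid's
    lemma removes the factor. *)
Lemma rough_prime_mul P m Q : isprime P = true -> (Q <= P)%nat ->
  rough Q (P * m) = rough Q m.
Proof.
  intros HP. induction Q as [ | Q IH ]; intros HQ; [ reflexivity | ].
  simpl. rewrite IH by lia. f_equal. f_equal.
  destruct (isprime Q) eqn:EQ; [ | reflexivity ]. simpl.
  rewrite divides_prime_mul by exact EQ.
  destruct (divides Q P) eqn:E; [ | reflexivity ].
  apply isprime_divides in E; [ lia | assumption | assumption ].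
Qed.

Lemma rough_1 P : rough P 1 = true.
Proof.
  induction P as [ | P IH ]; [ reflexivity | ]. simpl. rewrite IH. simpl.
  destruct (isprime P) eqn:E; [ | reflexivity ].
  destruct (divides P 1) eqn:E'; [ | reflexivity ].
  apply isprime_ge2 in E. apply divides_le in E'; lia.
Qed.

Lemma rough_small P n : (2 <= n)%nat -> (n < P)%nat -> rough P n = false.
Proof.
  intros H2 Hn. destruct (prime_divisor n H2) as [p [m [Hp E Hm Hmn]]].
  assert (Hpn : (p < P)%nat) by nia. clear Hn. revert Hpn.
  induction P as [ | P IH ]; intros HpP; [ lia | ].
  simpl. destruct (Nat.eq_dec p P) as [ <- | Hne ].
  - rewrite Hp, E, divides_mul. apply andb_false_r.
  - rewrite IH by lia. reflexivity.
Qed.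

Definition sieve (u : nat -> C) (P n : nat) : C := if rough P n then u n else RtoC 0.

Lemma Cmod_sieve_le u P n : Cmod (sieve u P n) <= Cmod (u n).
Proof.
  unfold sieve. destruct (rough P n); [ lra | rewrite Cmod_0; apply Cmod_ge_0 ].
Qed.

Lemma abs_summable_sieve u P : abs_summable u -> abs_summable (sieve u P).
Proof. apply abs_summable_le. apply Cmod_sieve_le. Qed.

(** The sieve of Eratosthenes: for prime [P], multiplying the sieved series by [u P] reproduces
    exactly its terms at multiples of [P], so the factor [1 - u P] deletes them. *)
Lemma CSeries_sieve (u : nat -> C) (P : nat) :
  (forall m n, u (m * n)%nat = (u m * u n)%C) -> abs_summable u ->
  CSeries (sieve u P) = (CSeries u * cprod_primes (fun p => (1 - u p)%C) P)%C.
Proof.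
  intros Hmul Hu. induction P as [ | P IH ].
  - simpl. rewrite Cmult_1_r. reflexivity.
  - pose proof (abs_summable_sieve u P Hu) as HP.
    simpl. destruct (isprime P) eqn:EP.
    + assert (P0 : (0 < P)%nat) by (apply isprime_ge2 in EP; lia).
      replace (CSeries u * (cprod_primes (fun p => 1 - u p) P * (1 - u P)))%C
        with (CSeries (sieve u P) - u P * CSeries (sieve u P))%C by (rewrite IH; ring).
      rewrite <- CSeries_scal by exact HP.
      rewrite (CSeries_ext (fun n => (u P * sieve u P n)%C) (fun m => sieve u P (P * m))).
      2:{ intro n. unfold sieve. rewrite rough_prime_mul, Hmul by (auto with arith).
          destruct (rough P n); [ reflexivity | ring ]. }
      rewrite <- CSeries_multiples by assumption.
      rewrite <- CSeries_minus.
      * apply CSeries_ext. intro n. unfold sieve. simpl. rewrite EP. simpl.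
        destruct (rough P n), (divides P n); simpl; ring.
      * exact HP.
      * apply abs_summable_le with (fun n => Cmod (u n)); [ | exact Hu ].
        intro n. destruct (divides P n); [ apply Cmod_sieve_le | ].
        rewrite Cmod_0; apply Cmod_ge_0.
    + rewrite <- IH. apply CSeries_ext. intro n. unfold sieve. simpl.
      rewrite EP. simpl. rewrite andb_true_r. reflexivity.
Qed.

Lemma Series_zero : Series (fun _ => 0) = 0.
Proof.
  rewrite (Series_ext _ (fun n => 0 * 0)) by (intro; ring). rewrite Series_scal_l. apply Rmult_0_l.
Qed.

Lemma is_lim_seq_tail (a : nat -> R) : ex_series a ->
  is_lim_seq (fun P => Series (fun k => a (P + k)%nat)) 0.
Proof.
  intros Ha. apply is_lim_seq_incr_1.
  apply is_lim_seq_ext with (fun n => Series a - sum_n a n).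
  - intro n. rewrite (Series_incr_n a (S n)) by (lia || assumption).
    rewrite sum_n_Reals. simpl Init.Nat.pred. ring.
  - replace (Finite 0) with (Finite (Series a - Series a)) by (f_equal; ring).
    apply is_lim_seq_minus'; [ apply is_lim_seq_const | ].
    apply (Series_correct a Ha).
Qed.

(** Padded with zeros instead of shifted, so that it can be compared with other series index by
    index. *)
Definition tail (P : nat) (a : nat -> R) (n : nat) : R := if (n <? P)%nat then 0 else a n.

Lemma Series_tail P a : Series (tail P a) = Series (fun k => a (P + k)%nat).
Proof.
  rewrite (Series_incr_n_aux (tail P a) P).
  - apply Series_ext. intro n. unfold tail.
    destruct (Nat.ltb_spec (P + n) P); [ lia | reflexivity ].
  - intros k Hk. unfold tail. destruct (Nat.ltb_spec k P); [ reflexivity | lia ].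
Qed.

Lemma ex_series_tail P a : (forall n, 0 <= a n) -> ex_series a -> ex_series (tail P a).
Proof.
  intros Ha. apply ex_series_le_abs. intro n. unfold tail. specialize (Ha n).
  destruct (n <? P)%nat; [ rewrite Rabs_R0 | rewrite Rabs_pos_eq ]; lra.
Qed.

(** Writes the number 1 as a series, to be subtracted term by term from a sieved one. *)
Definition unit_at_1 (n : nat) : R := if (n =? 1)%nat then 1 else 0.

Lemma ex_series_unit_at_1 : ex_series (fun n => Rabs (unit_at_1 n)).
Proof.
  apply ex_series_le_abs with (fun n => 2 * (/ 2) ^ n).
  - intro n. rewrite Rabs_Rabsolu. unfold unit_at_1. destruct (Nat.eqb_spec n 1) as [ -> | _ ].
    + rewrite Rabs_R1. simpl. lra.
    + rewrite Rabs_R0. pose proof (pow_lt (/ 2) n). lra.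
  - apply (ex_series_scal_l 2 (fun n => (/ 2) ^ n)). apply ex_series_geom.
    rewrite Rabs_pos_eq; lra.
Qed.

Lemma Series_unit_at_1 : Series unit_at_1 = 1.
Proof.
  rewrite (Series_incr_n unit_at_1 2); [ | lia | ].
  - simpl. rewrite (Series_ext _ (fun _ => 0)) by reflexivity.
    rewrite Series_zero. unfold unit_at_1; simpl. ring.
  - apply ex_series_Rabs, ex_series_unit_at_1.
Qed.

(** After sieving by the primes below [P], only the index 1 and indices [n >= P] survive, so the
    error is at most a tail of the series of moduli. *)
Lemma euler_product (u : nat -> C) :
  (forall m n, u (m * n)%nat = (u m * u n)%C) -> u O = RtoC 0 -> u 1%nat = RtoC 1 ->
  abs_summable u ->
  is_lim_seq (fun P => Cmod (CSeries u * cprod_primes (fun p => (1 - u p)%C) P - 1)) 0.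
Proof.
  intros Hmul H0 H1 Hu.
  apply is_lim_seq_le_le_loc
    with (u := fun _ => 0) (w := fun P => Series (fun k => Cmod (u (P + k)%nat))).
  (* [P >= 2] puts the index 1 below the cut, so [unit_at_1] vanishes on the tail. *)
  - exists 2%nat. intros P HP. split; [ apply Cmod_ge_0 | ].
    rewrite <- CSeries_sieve by assumption.
    rewrite <- Series_unit_at_1, <- CSeries_RtoC, <- CSeries_minus.
    + rewrite <- (Series_tail P (fun n => Cmod (u n))).
      apply Cmod_CSeries_le; [ | apply ex_series_tail; [ intro; apply Cmod_ge_0 | exact Hu ] ].
      intro n. unfold tail. destruct (Nat.ltb_spec n P) as [ Hn | Hn ].
      * apply Req_le. rewrite <- Cmod_0. f_equal. unfold sieve, unit_at_1.
        destruct n as [ | [ | n ] ].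
        -- simpl. rewrite H0. destruct (rough P 0); ring.
        -- rewrite rough_1, H1. simpl. ring.
        -- rewrite rough_small by lia. simpl. ring.
      * replace (unit_at_1 n) with 0
          by (unfold unit_at_1; destruct (Nat.eqb_spec n 1); [ lia | reflexivity ]).
        replace (sieve u P n - 0)%C with (sieve u P n) by ring. apply Cmod_sieve_le.
    + apply abs_summable_sieve, Hu.
    + apply abs_summable_le with (fun n => Rabs (unit_at_1 n)); [ | apply ex_series_unit_at_1 ].
      intro n. rewrite Cmod_R. lra.
  - apply is_lim_seq_const.
  - apply (is_lim_seq_tail (fun n => Cmod (u n))), Hu.
Qed.

Lemma Cmod_euler_product (u : nat -> C) :
  (forall m n, u (m * n)%nat = (u m * u n)%C) -> u O = RtoC 0 -> u 1%nat = RtoC 1 ->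
  abs_summable u ->
  is_lim_seq (fun P => Cmod (CSeries u) * Cmod (cprod_primes (fun p => (1 - u p)%C) P)) 1.
Proof.
  intros Hmul H0 H1 Hu.
  pose proof (euler_product u Hmul H0 H1 Hu) as H.
  apply is_lim_seq_le_le with
    (u := fun P => 1 - Cmod (CSeries u * cprod_primes (fun p => (1 - u p)%C) P - 1))
    (w := fun P => 1 + Cmod (CSeries u * cprod_primes (fun p => (1 - u p)%C) P - 1)).
  - intro P. rewrite <- Cmod_mult.
    set (z := (CSeries u * cprod_primes (fun p => 1 - u p) P)%C).
    pose proof (Cmod_triangle (z - 1) 1) as T1.
    pose proof (Cmod_triangle z (- (z - 1))) as T2.
    rewrite Cmod_opp in T2.
    replace (z - 1 + 1)%C with z in T1 by ring.
    replace (z + - (z - 1))%C with (RtoC 1) in T2 by ring.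
    rewrite Cmod_1 in *. lra.
  - replace (Finite 1) with (Finite (1 - 0)) by (f_equal; ring).
    apply is_lim_seq_minus'; [ apply is_lim_seq_const | exact H ].
  - replace (Finite 1) with (Finite (1 + 0)) by (f_equal; ring).
    apply is_lim_seq_plus'; [ apply is_lim_seq_const | exact H ].
Qed.

Lemma cprod_primes_RtoC (v : nat -> R) P :
  cprod_primes (fun p => (1 - RtoC (v p))%C) P = RtoC (prod_primes (fun p => 1 - v p) P).
Proof.
  induction P as [ | P IH ]; [ reflexivity | ]. simpl.
  destruct (isprime P); [ | exact IH ]. rewrite IH, RtoC_mult, RtoC_minus. reflexivity.
Qed.

Lemma euler_product_real (v : nat -> R) :
  (forall m n, v (m * n)%nat = v m * v n) -> v O = 0 -> v 1%nat = 1 ->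
  ex_series (fun n => Rabs (v n)) ->
  is_lim_seq (fun P => Series v * prod_primes (fun p => 1 - v p) P) 1.
Proof.
  intros Hmul H0 H1 Hv.
  pose proof (euler_product (fun n => RtoC (v n))) as H. cbv beta in H.
  specialize (H ltac:(intros; rewrite Hmul, RtoC_mult; reflexivity)
    ltac:(rewrite H0; reflexivity) ltac:(rewrite H1; reflexivity)).
  specialize (H ltac:(unfold abs_summable; apply ex_series_ext with (2 := Hv);
    intro; rewrite Cmod_R; reflexivity)).
  apply is_lim_seq_ext
    with (fun P => (Series v * prod_primes (fun p => 1 - v p) P - 1) + 1); [ intro; ring | ].
  replace (Finite 1) with (Finite (0 + 1)) by (f_equal; ring).
  apply is_lim_seq_plus'; [ | apply is_lim_seq_const ].
  apply is_lim_seq_abs_0. eapply is_lim_seq_ext; [ | exact H ].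
  intro P. simpl. rewrite CSeries_RtoC, cprod_primes_RtoC, <- RtoC_mult, <- RtoC_minus, Cmod_R.
  reflexivity.
Qed.

(** * Zeta and the Liouville series on the half-plane [Re s > 1] *)

Definition rzeta (x : R) : R := Series (rpow x).
Definition lseries (x : R) : R := Series (fun n => liouville n * rpow x n).

Lemma abs_summable_cpow s : 1 < Re s -> abs_summable (cpow s).
Proof.
  intros Hs. apply ex_series_ext with (rpow (Re s)); [ | apply ex_series_rpow, Hs ].
  intro n. symmetry. apply Cmod_cpow.
Qed.

Lemma zeta_CSeries s : 1 < Re s -> zeta s = CSeries (cpow s).
Proof.
  intros Hs. unfold zeta. destruct (Rlt_dec 1 (Re s)); [ | contradiction ].
  (* Dropping the zero term of [cpow] at 0 accounts for the shift built into [zeta_term]. *)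
  unfold zeta_series, CSeries. f_equal; symmetry;
    apply Series_incr_1_aux; reflexivity.
Qed.

Lemma zeta_RtoC x : 1 < x -> zeta (RtoC x) = RtoC (rzeta x).
Proof.
  intros Hx. rewrite zeta_CSeries by exact Hx. unfold rzeta. rewrite <- CSeries_RtoC.
  apply CSeries_ext. intro n. apply cpow_RtoC.
Qed.

Lemma Rabs_liouville_rpow x n : Rabs (liouville n * rpow x n) <= rpow x n.
Proof.
  rewrite Rabs_mult, (Rabs_pos_eq (rpow x n)) by apply rpow_ge0.
  pose proof (Rabs_liouville_le n). pose proof (rpow_ge0 x n). nra.
Qed.

Lemma ex_series_liouville x : 1 < x -> ex_series (fun n => Rabs (liouville n * rpow x n)).
Proof.
  intros Hx. apply ex_series_le_abs with (rpow x); [ | apply ex_series_rpow, Hx ].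
  intro n. rewrite Rabs_Rabsolu. apply Rabs_liouville_rpow.
Qed.

Lemma prod_primes_ext g h P : (forall p, isprime p = true -> g p = h p) ->
  prod_primes g P = prod_primes h P.
Proof.
  intros H. induction P as [ | P IH ]; [ reflexivity | ]. simpl.
  destruct (isprime P) eqn:E; [ | exact IH ]. rewrite IH, H by exact E. reflexivity.
Qed.

Lemma prod_primes_mul g h P :
  prod_primes (fun p => g p * h p) P = prod_primes g P * prod_primes h P.
Proof.
  induction P as [ | P IH ]; simpl; [ ring | ].
  destruct (isprime P); [ rewrite IH; ring | exact IH ].
Qed.

Lemma prod_primes_ge0 g P : (forall p, isprime p = true -> 0 <= g p) -> 0 <= prod_primes g P.
Proof.
  intros H. induction P as [ | P IH ]; simpl; [ lra | ].
  destruct (isprime P) eqn:E; [ apply Rmult_le_pos; auto | exact IH ].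
Qed.

Lemma rzeta_euler x : 1 < x ->
  is_lim_seq (fun P => rzeta x * prod_primes (fun p => 1 - rpow x p) P) 1.
Proof.
  intros Hx. apply euler_product_real.
  - apply rpow_mul.
  - reflexivity.
  - apply rpow_1.
  - apply ex_series_ext with (rpow x); [ | apply ex_series_rpow, Hx ].
    intro n. rewrite Rabs_pos_eq by apply rpow_ge0. reflexivity.
Qed.

Lemma lseries_euler x : 1 < x ->
  is_lim_seq (fun P => lseries x * prod_primes (fun p => 1 + rpow x p) P) 1.
Proof.
  intros Hx.
  apply is_lim_seq_ext
    with (fun P => lseries x * prod_primes (fun p => 1 - liouville p * rpow x p) P).
  - intro P. f_equal. apply prod_primes_ext. intros p Hp. rewrite liouville_prime by exact Hp. ring.
  - apply (euler_product_real (fun n => liouville n * rpow x n)).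
    + intros m n. rewrite liouville_mul, rpow_mul. ring.
    + simpl. ring.
    + rewrite liouville1, rpow_1. ring.
    + apply ex_series_liouville, Hx.
Qed.

(** Yields positivity and non-vanishing of a sum from its Euler product, without any lower bound on
    the finite products. *)
Lemma is_lim_seq_pos_factor (c : R) (e : nat -> R) :
  (forall n, 0 <= e n) -> is_lim_seq (fun n => c * e n) 1 -> 0 < c.
Proof.
  intros He H. destruct (Rlt_or_le 0 c) as [ Hc | Hc ]; [ exact Hc | exfalso ].
  assert (H' : Rbar_le 1 0).
  { apply is_lim_seq_le with (3 := is_lim_seq_const 0) (2 := H).
    intro n. specialize (He n). nra. }
  simpl in H'. lra.
Qed.

Lemma prod_primes_1p_ge0 x P : 0 <= prod_primes (fun p => 1 + rpow x p) P.
Proof. apply prod_primes_ge0. intros p _. pose proof (rpow_ge0 x p). lra. Qed.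

Lemma lseries_pos x : 1 < x -> 0 < lseries x.
Proof.
  intros Hx. eapply is_lim_seq_pos_factor; [ | apply lseries_euler, Hx ].
  intro P. apply prod_primes_1p_ge0.
Qed.

Lemma rzeta_pos x : 1 < x -> 0 < rzeta x.
Proof.
  intros Hx. eapply is_lim_seq_pos_factor; [ | apply rzeta_euler, Hx ].
  intro P. apply prod_primes_ge0. intros p Hp.
  pose proof (rpow_lt1 x p ltac:(lra) (isprime_ge2 p Hp)). lra.
Qed.

(** [a] and [b] are the reciprocals of the limits of [e] and [e'], so comparing Euler factors
    compares the sums in the opposite order. *)
Lemma is_lim_seq_compare (a b : R) (e e' : nat -> R) : 0 < a -> 0 < b ->
  (exists N, forall n, (N <= n)%nat -> e' n <= e n) ->
  is_lim_seq (fun n => a * e n) 1 -> is_lim_seq (fun n => b * e' n) 1 -> a <= b.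
Proof.
  intros Ha Hb [N Hle] H H'.
  apply (is_lim_seq_scal_l _ (a / b)) in H'.
  assert (L : Rbar_le (Rbar_mult (a / b) 1) 1).
  { apply is_lim_seq_le_loc with (2 := H') (3 := H). exists N. intros n Hn.
    specialize (Hle n Hn). replace (a / b * (b * e' n)) with (a * e' n) by (field; lra). nra. }
  simpl in L. apply Rmult_le_reg_r with (/ b); [ apply Rinv_0_lt_compat, Hb | ].
  rewrite Rinv_r by lra. unfold Rdiv in L. lra.
Qed.

(** Factor by factor, [(1 + p^{-x}) (1 - p^{-x}) = 1 - p^{-2x}]; both sides then have the same Euler
    product. *)
Lemma lseries_rzeta x : 1 < x -> lseries x * rzeta x = rzeta (2 * x).
Proof.
  intros Hx.
  assert (H : is_lim_seq
    (fun P => (lseries x * rzeta x) * prod_primes (fun p => 1 - rpow (2 * x) p) P) 1).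
  { apply is_lim_seq_ext with (fun P =>
      (lseries x * prod_primes (fun p => 1 + rpow x p) P)
      * (rzeta x * prod_primes (fun p => 1 - rpow x p) P)).
    - intro P. rewrite (prod_primes_ext (fun p => 1 - rpow (2 * x) p)
        (fun p => (1 + rpow x p) * (1 - rpow x p))).
      + rewrite prod_primes_mul. ring.
      + intros p _. rewrite rpow_double. ring.
    - replace (Finite 1) with (Finite (1 * 1)) by (f_equal; ring).
      apply is_lim_seq_mult'; [ apply lseries_euler, Hx | apply rzeta_euler, Hx ]. }
  pose proof (rzeta_euler (2 * x) ltac:(lra)) as H2.
  pose proof (lseries_pos x Hx). pose proof (rzeta_pos x Hx).
  pose proof (rzeta_pos (2 * x) ltac:(lra)).
  assert (0 < lseries x * rzeta x) by (apply Rmult_lt_0_compat; assumption).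
  apply Rle_antisym; eapply is_lim_seq_compare; try eassumption;
    exists O; intros; lra.
Qed.

(** Each factor satisfies [|1 - p^{-s}| <= 1 + p^{-Re s}]. *)
Lemma Cmod_zeta_ge s : 1 < Re s -> lseries (Re s) <= Cmod (zeta s).
Proof.
  intros Hs. rewrite zeta_CSeries by exact Hs.
  pose proof (Cmod_euler_product (cpow s) (cpow_mul s) eq_refl (cpow_1 s)
    (abs_summable_cpow s Hs)) as H.
  assert (Hz : 0 < Cmod (CSeries (cpow s))).
  { eapply is_lim_seq_pos_factor; [ | exact H ]. intro; apply Cmod_ge_0. }
  eapply is_lim_seq_compare;
    [ apply lseries_pos, Hs | exact Hz | | apply lseries_euler, Hs | exact H ].
  exists O. intros P _. induction P as [ | P IH ]; simpl; [ rewrite Cmod_1; lra | ].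
  destruct (isprime P); [ | exact IH ]. rewrite Cmod_mult.
  apply Rmult_le_compat; [ apply Cmod_ge_0 | apply Cmod_ge_0 | exact IH | ].
  eapply Rle_trans; [ apply Cmod_triangle | ]. rewrite Cmod_1, Cmod_opp, Cmod_cpow. lra.
Qed.

(* Only the factors at primes other than 2 are compared; the factor at 2 is
   kept to obtain strict monotonicity with an explicit rate. *)
Lemma lseries_growth x y : 1 < x -> x <= y ->
  lseries x * (1 + rpow x 2) <= lseries y * (1 + rpow y 2).
Proof.
  intros Hx Hxy.
  pose proof (rpow_ge0 x 2) as Hx2. pose proof (rpow_ge0 y 2) as Hy2.
  assert (Hdiv : forall z, 1 < z -> is_lim_seq (fun P => (lseries z * (1 + rpow z 2)) *
      (prod_primes (fun p => 1 + rpow z p) P / (1 + rpow z 2))) 1).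
  { intros z Hz. eapply is_lim_seq_ext; [ | apply lseries_euler, Hz ].
    intro P. cbv beta. pose proof (rpow_ge0 z 2). field. lra. }
  assert (Hy : 1 < y) by lra.
  apply is_lim_seq_compare with (4 := Hdiv x Hx) (5 := Hdiv y Hy).
  - apply Rmult_lt_0_compat; [ apply lseries_pos, Hx | lra ].
  - apply Rmult_lt_0_compat; [ apply lseries_pos; lra | lra ].
  (* From [P = 3] on, the product contains the factor at 2, which the division cancels. *)
  - exists 3%nat. intros P HP. induction HP as [ | P HP IH ].
    + change (prod_primes (fun p => 1 + rpow y p) 3) with (1 * (1 + rpow y 2)).
      change (prod_primes (fun p => 1 + rpow x p) 3) with (1 * (1 + rpow x 2)).
      apply Req_le. field. lra.
    + simpl prod_primes. destruct (isprime P); [ | exact IH ].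
      replace (prod_primes (fun p => 1 + rpow y p) P * (1 + rpow y P) / (1 + rpow y 2))
        with (prod_primes (fun p => 1 + rpow y p) P / (1 + rpow y 2) * (1 + rpow y P))
        by (field; lra).
      replace (prod_primes (fun p => 1 + rpow x p) P * (1 + rpow x P) / (1 + rpow x 2))
        with (prod_primes (fun p => 1 + rpow x p) P / (1 + rpow x 2) * (1 + rpow x P))
        by (field; lra).
      pose proof (rpow_ge0 y P). pose proof (rpow_le x y P Hxy).
      apply Rmult_le_compat; [ | lra | exact IH | lra ].
      apply Rmult_le_pos; [ apply prod_primes_1p_ge0 | ].
      left; apply Rinv_0_lt_compat; lra.
Qed.

(** * Simultaneous approximation of the phases [t ln p] *)

(* A bounded antiderivative of [A - mu] forces the long-time average of [A] to
   be [mu]; this replaces integration. *)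
Definition has_mean (A : R -> R) (mu : R) : Prop :=
  exists G M, (forall t, is_derive G t (A t - mu)) /\ (forall t, Rabs (G t) <= M).

Lemma has_mean_plus A B a b : has_mean A a -> has_mean B b ->
  has_mean (fun t => A t + B t) (a + b).
Proof.
  intros [G [M [HG HM]]] [G' [M' [HG' HM']]].
  exists (fun t => G t + G' t), (M + M'). split; intro t.
  - replace (A t + B t - (a + b)) with ((A t - a) + (B t - b)) by ring.
    apply (is_derive_plus G G'); auto.
  - eapply Rle_trans; [ apply Rabs_triang | apply Rplus_le_compat; auto ].
Qed.

Lemma has_mean_scal c A a : has_mean A a -> has_mean (fun t => c * A t) (c * a).
Proof.
  intros [G [M [HG HM]]]. exists (fun t => c * G t), (Rabs c * M). split; intro t.
  - replace (c * A t - c * a) with (c * (A t - a)) by ring. apply is_derive_scal, HG.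
  - rewrite Rabs_mult. apply Rmult_le_compat_l; [ apply Rabs_pos | apply HM ].
Qed.

Lemma has_mean_const c : has_mean (fun _ => c) c.
Proof.
  exists (fun _ => 0), 0. split; intro t.
  - replace (c - c) with 0 by ring. apply (is_derive_const 0 t).
  - rewrite Rabs_R0. lra.
Qed.

Lemma has_mean_cos w : w <> 0 -> has_mean (fun t => cos (w * t)) 0.
Proof.
  intros Hw. exists (fun t => / w * sin (w * t)), (Rabs (/ w)). split; intro t.
  - auto_derive; [ tauto | ]. field. exact Hw.
  - rewrite Rabs_mult.
    assert (Rabs (sin (w * t)) <= 1) by apply Rabs_le, SIN_bound.
    pose proof (Rabs_pos (/ w)). nra.
Qed.

Lemma has_mean_ext A B a : (forall t, A t = B t) -> has_mean A a -> has_mean B a.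
Proof.
  intros H [G [M [HG HM]]]. exists G, M. split; [ | exact HM ].
  intro t. rewrite <- H. apply HG.
Qed.

(** If [a < 0], the antiderivative grows at rate at least [- a]; over the length [T] it gains
    [2 M + 1], more than its bound [M] permits. *)
Lemma has_mean_ge0 A a : (forall t, 0 <= A t) -> has_mean A a -> 0 <= a.
Proof.
  intros HA [G [M [HG HM]]].
  destruct (Rle_or_lt 0 a) as [ H | H ]; [ exact H | exfalso ].
  assert (HM0 : 0 <= M) by (eapply Rle_trans; [ apply Rabs_pos | apply (HM 0) ]).
  set (T := (2 * M + 1) / - a).
  assert (HT : 0 < T) by (apply Rdiv_lt_0_compat; lra).
  destruct (MVT_gen G 0 T (fun t => A t - a)) as [xi [_ E]].
  - intros; apply HG.
  - intros x _. apply continuity_pt_filterlim, (ex_derive_continuous G). eexists; apply HG.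
  - assert (E' : - a * T = 2 * M + 1) by (unfold T; field; lra).
    pose proof (HA xi) as Hxi.
    pose proof (proj1 (Rabs_le_between _ _) (HM 0)) as H0.
    pose proof (proj1 (Rabs_le_between _ _) (HM T)) as H1.
    nra.
Qed.

(** Cosine polynomials in a single angle, with their constant term. At the angle [t ln p] the
    frequency [j] turns into [ln (p^j)]. *)
Inductive trig1 : (R -> R) -> R -> Prop :=
  | trig1_const c : trig1 (fun _ => c) c
  | trig1_cos j : (0 < j)%nat -> trig1 (fun x => cos (INR j * x)) 0
  | trig1_plus A B a b : trig1 A a -> trig1 B b -> trig1 (fun x => A x + B x) (a + b)
  | trig1_scal c A a : trig1 A a -> trig1 (fun x => c * A x) (c * a)
  | trig1_ext A B a b : (forall x, A x = B x) -> a = b -> trig1 A a -> trig1 B b.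

Definition smooth (P m : nat) : Prop :=
  (0 < m)%nat /\ forall q, isprime q = true -> (P <= q)%nat -> divides q m = false.

(* Trigonometric polynomials whose non-zero frequencies are logarithms of
   ratios of integers built from the primes below [P]; the last argument is
   the constant term. *)
Inductive trig (P : nat) : (R -> R) -> R -> Prop :=
  | trig_const c : trig P (fun _ => c) c
  | trig_cos m n : smooth P m -> smooth P n -> m <> n ->
      trig P (fun t => cos ((ln (INR m) - ln (INR n)) * t)) 0
  | trig_plus A B a b : trig P A a -> trig P B b -> trig P (fun t => A t + B t) (a + b)
  | trig_scal c A a : trig P A a -> trig P (fun t => c * A t) (c * a)
  | trig_ext A B a b : (forall t, A t = B t) -> a = b -> trig P A a -> trig P B b.

(** Injectivity of [ln] makes each frequency [ln m - ln n] non-zero, so every cosine averages to 0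
    and the constant term remains. *)
Lemma trig_has_mean P A a : trig P A a -> has_mean A a.
Proof.
  induction 1 as [ c | m n [Hm _] [Hn _] Hne | A B a b _ IHA _ IHB | c A a _ IH
    | A B a b HAB Hab _ IH ].
  - apply has_mean_const.
  - apply has_mean_cos. intro E. apply Hne, INR_eq.
    apply ln_inv; [ apply lt_0_INR, Hm | apply lt_0_INR, Hn | lra ].
  - apply has_mean_plus; assumption.
  - apply has_mean_scal; assumption.
  - subst b. apply has_mean_ext with A; assumption.
Qed.

Lemma smooth_S P m : smooth P m -> smooth (S P) m.
Proof. intros [H0 H]. split; [ exact H0 | ]. intros q Hq HP. apply H; [ exact Hq | lia ]. Qed.

Lemma smooth_mul P m n : smooth P m -> smooth P n -> smooth P (m * n).
Proof.
  intros [Hm0 Hm] [Hn0 Hn]. split; [ lia | ].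
  intros q Hq HP. rewrite divides_prime_mul, Hm, Hn by assumption. reflexivity.
Qed.

Lemma smooth_1 P : smooth P 1.
Proof.
  split; [ lia | ]. intros q Hq _. destruct (divides q 1) eqn:E; [ | reflexivity ].
  apply divides_le in E; [ | lia ]. apply isprime_ge2 in Hq. lia.
Qed.

Lemma smooth_pow P j : isprime P = true -> smooth (S P) (P ^ j).
Proof.
  intros HP. split.
  - pose proof (isprime_ge2 P HP). pose proof (Nat.pow_nonzero P j). lia.
  - intros q Hq Hle. destruct (divides q (P ^ j)) eqn:E; [ | reflexivity ].
    apply divides_prime_pow in E; [ lia | assumption | assumption ].
Qed.

(** [P] divides the left side but not [n]. This is the arithmetic form of the linear independence of
    the [ln p]. *)
Lemma smooth_mul_pow_neq P m n j : isprime P = true -> (0 < j)%nat ->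
  smooth P n -> (m * P ^ j)%nat <> n.
Proof.
  intros HP Hj [_ Hn] <-. specialize (Hn P HP (le_n P)).
  destruct j as [ | j ]; [ lia | ].
  replace (m * P ^ S j)%nat with (P * (m * P ^ j))%nat in Hn by (simpl; ring).
  rewrite divides_mul in Hn. discriminate.
Qed.

Lemma trig_S P A a : trig P A a -> trig (S P) A a.
Proof.
  induction 1 as [ c | m n Hm Hn Hne | A B a b _ IHA _ IHB | c A a _ IH
    | A B a b HAB Hab _ IH ].
  - apply trig_const.
  - apply trig_cos; [ apply smooth_S, Hm | apply smooth_S, Hn | exact Hne ].
  - apply trig_plus; assumption.
  - apply trig_scal; assumption.
  - apply trig_ext with A a; assumption.
Qed.

Lemma ln_INR_mul_pow m P j : (0 < m)%nat -> (0 < P)%nat ->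
  ln (INR (m * P ^ j)) = ln (INR m) + INR j * ln (INR P).
Proof.
  intros Hm HP. rewrite mult_INR, pow_INR, ln_mult, ln_pow; [ reflexivity | .. ];
    try (apply pow_lt); apply lt_0_INR; assumption.
Qed.

Lemma cos_mul_cos x y : cos x * cos y = / 2 * cos (x + y) + / 2 * cos (x - y).
Proof. rewrite cos_plus, cos_minus. field. Qed.

(** The product-to-sum formula moves [P^j] into the numerator or the denominator of [m / n]. The new
    ratio is never 1 by [smooth_mul_pow_neq], so no constant term arises. *)
Lemma trig_mul_cos P A a j : isprime P = true -> (0 < j)%nat -> trig P A a ->
  trig (S P) (fun t => A t * cos (INR j * (t * ln (INR P)))) 0.
Proof.
  intros HP Hj. assert (P0 : (0 < P)%nat) by (apply isprime_ge2 in HP; lia).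
  induction 1 as [ c | m n Hm Hn Hne | A B a b _ IHA _ IHB | c A a _ IH
    | A B a b HAB Hab _ IH ].
  - apply trig_ext with (fun t => c * cos ((ln (INR (1 * P ^ j)) - ln (INR 1)) * t)) (c * 0).
    + intro t. rewrite ln_INR_mul_pow by lia. do 2 f_equal. ring.
    + ring.
    + apply trig_scal, trig_cos.
      * apply smooth_mul; [ apply smooth_1 | apply smooth_pow, HP ].
      * apply smooth_1.
      * apply (smooth_mul_pow_neq P); [ assumption | assumption | apply smooth_1 ].
  - apply trig_ext with (fun t => / 2 * cos ((ln (INR (m * P ^ j)) - ln (INR n)) * t)
      + / 2 * cos ((ln (INR m) - ln (INR (n * P ^ j))) * t)) (/ 2 * 0 + / 2 * 0).
    + intro t. rewrite cos_mul_cos. destruct Hm as [Hm _], Hn as [Hn _].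
      rewrite !ln_INR_mul_pow by assumption. f_equal; do 2 f_equal; ring.
    + ring.
    + apply trig_plus; apply trig_scal, trig_cos.
      * apply smooth_mul; [ apply smooth_S, Hm | apply smooth_pow, HP ].
      * apply smooth_S, Hn.
      * apply (smooth_mul_pow_neq P); assumption.
      * apply smooth_S, Hm.
      * apply smooth_mul; [ apply smooth_S, Hn | apply smooth_pow, HP ].
      * apply not_eq_sym, (smooth_mul_pow_neq P); assumption.
  - eapply trig_ext; [ | | apply trig_plus; [ exact IHA | exact IHB ] ].
    + intro t. simpl. ring.
    + ring.
  - eapply trig_ext; [ | | apply (trig_scal _ c); exact IH ].
    + intro t. simpl. ring.
    + ring.
  - eapply trig_ext; [ | | exact IH ].
    + intro t. simpl. rewrite HAB. reflexivity.
    + reflexivity.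
Qed.

(** Constant terms multiply: the phase of the new prime [P] is asymptotically independent of those
    of the smaller primes. *)
Lemma trig_mul_trig1 P A a F mu : isprime P = true -> trig P A a -> trig1 F mu ->
  trig (S P) (fun t => A t * F (t * ln (INR P))) (a * mu).
Proof.
  intros HP HA. induction 1 as [ c | j Hj | F G f g _ IHF _ IHG | c F f _ IH
    | F G f g HFG Hfg _ IH ].
  - eapply trig_ext; [ | | apply (trig_scal _ c), trig_S, HA ].
    + intro t. simpl. ring.
    + ring.
  - eapply trig_ext; [ | | apply (trig_mul_cos P A a j HP Hj HA) ].
    + reflexivity.
    + ring.
  - eapply trig_ext; [ | | apply trig_plus; [ exact IHF | exact IHG ] ].
    + intro t. simpl. ring.
    + ring.
  - eapply trig_ext; [ | | apply (trig_scal _ c); exact IH ].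
    + intro t. simpl. ring.
    + ring.
  - eapply trig_ext; [ | | exact IH ].
    + intro t. simpl. rewrite HFG. reflexivity.
    + rewrite Hfg. reflexivity.
Qed.

Lemma trig_prod_primes (F : nat -> R -> R) (mu : nat -> R) P :
  (forall p, trig1 (F p) (mu p)) ->
  trig P (fun t => prod_primes (fun p => F p (t * ln (INR p))) P) (prod_primes mu P).
Proof.
  intros HF. induction P as [ | P IH ]; [ exact (trig_const 0 1) | ].
  simpl. destruct (isprime P) eqn:E.
  - apply trig_mul_trig1; [ exact E | exact IH | apply HF ].
  - apply trig_S, IH.
Qed.

(* Shifted by [PI] from the usual ones, so that they peak at [PI]. *)
Fixpoint dirichlet (k : nat) (x : R) : R :=
  match k with
  | O => 1
  | S i => dirichlet i x + 2 * (-1) ^ k * cos (INR k * x)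
  end.

Fixpoint fejer_sum (k : nat) (x : R) : R :=
  match k with
  | O => 1
  | S i => fejer_sum i x + dirichlet k x
  end.

Definition fejer (k : nat) (x : R) : R := / INR (S k) * fejer_sum k x.

Lemma dirichlet_trig1 k : trig1 (dirichlet k) 1.
Proof.
  induction k as [ | k IH ]; [ exact (trig1_const 1) | ].
  eapply trig1_ext; [ | | apply trig1_plus; [ exact IH |
    apply (trig1_scal (2 * (-1) ^ S k)), (trig1_cos (S k)); lia ] ].
  - reflexivity.
  - ring.
Qed.

Lemma fejer_trig1 k : trig1 (fejer k) 1.
Proof.
  assert (H : trig1 (fejer_sum k) (INR (S k))).
  { induction k as [ | k IH ]; [ exact (trig1_const 1) | ].
    eapply trig1_ext; [ | | apply trig1_plus; [ exact IH | apply (dirichlet_trig1 (S k)) ] ].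
    - reflexivity.
    - symmetry; apply (S_INR (S k)). }
  eapply trig1_ext; [ | | apply (trig1_scal (/ INR (S k))), H ].
  - reflexivity.
  - apply Rinv_l, not_0_INR. lia.
Qed.

(** The closed form of the kernel with its denominator cleared, hence valid also where
    [1 + cos x = 0]. *)
Lemma dirichlet_mul k x :
  dirichlet k x * (1 + cos x) = (-1) ^ k * (cos (INR k * x) + cos (INR (S k) * x)).
Proof.
  induction k as [ | k IH ].
  - simpl. rewrite Rmult_0_l, !Rmult_1_l, cos_0. ring.
  - change (dirichlet (S k) x)
      with (dirichlet k x + 2 * (-1) ^ S k * cos (INR (S k) * x)).
    rewrite Rmult_plus_distr_r, IH.
    assert (E : 2 * (cos (INR (S k) * x) * cos x)
      = cos (INR (S (S k)) * x) + cos (INR k * x)).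
    { rewrite cos_mul_cos. rewrite (S_INR (S k)), (S_INR k).
      replace ((INR k + 1) * x + x) with ((INR k + 1 + 1) * x) by ring.
      replace ((INR k + 1) * x - x) with (INR k * x) by ring. field. }
    rewrite <- !tech_pow_Rmult.
    replace (2 * (-1 * (-1) ^ k) * cos (INR (S k) * x) * (1 + cos x))
      with (- (-1) ^ k * (2 * cos (INR (S k) * x) + 2 * (cos (INR (S k) * x) * cos x))) by ring.
    rewrite E. ring.
Qed.

(** The right-hand sides of [dirichlet_mul] telescope in [k]. The bounded numerator over [k + 1]
    shows how the kernel concentrates where [cos x = -1]. *)
Lemma fejer_mul k x :
  fejer k x * (1 + cos x) = / INR (S k) * (1 + (-1) ^ k * cos (INR (S k) * x)).
Proof.
  unfold fejer. rewrite Rmult_assoc. f_equal. induction k as [ | k IH ].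
  - simpl. rewrite !Rmult_1_l. reflexivity.
  - change (fejer_sum (S k) x) with (fejer_sum k x + dirichlet (S k) x).
    rewrite Rmult_plus_distr_r, IH, dirichlet_mul, <- tech_pow_Rmult. ring.
Qed.

(** Where [1 + cos x > 0] the sign is read off [fejer_mul]. Where it vanishes, [cos (j x) = (-1)^j]
    and every term of the Dirichlet kernels is non-negative. *)
Lemma fejer_ge0 k x : 0 <= fejer k x.
Proof.
  assert (Hk : 0 < / INR (S k)) by (apply Rinv_0_lt_compat, lt_0_INR; lia).
  destruct (Req_dec (1 + cos x) 0) as [ E | E ].
  - assert (Hc : cos x = -1) by lra.
    assert (Hs : sin x = 0).
    { pose proof (sin2_cos2 x) as H. rewrite Hc in H. unfold Rsqr in H. nra. }
    assert (Hcos : forall j, cos (INR j * x) = (-1) ^ j).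
    { intro j. enough (cos (INR j * x) = (-1) ^ j /\ sin (INR j * x) = 0) by tauto.
      induction j as [ | j [IHc IHs] ].
      - simpl. rewrite Rmult_0_l, cos_0, sin_0. tauto.
      - rewrite S_INR, Rmult_plus_distr_r, Rmult_1_l, cos_plus, sin_plus, IHc, IHs, Hc, Hs.
        simpl. split; ring. }
    assert (Hd : forall j, 0 <= dirichlet j x).
    { induction j as [ | j IH ]; [ simpl; lra | ].
      change (dirichlet (S j) x) with (dirichlet j x + 2 * (-1) ^ S j * cos (INR (S j) * x)).
      rewrite Hcos. pose proof (Rle_0_sqr ((-1) ^ S j)) as H. unfold Rsqr in H. nra. }
    apply Rmult_le_pos; [ lra | ].
    induction k as [ | k IH ]; [ simpl; lra | ].
    change (fejer_sum (S k) x) with (fejer_sum k x + dirichlet (S k) x).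
    specialize (Hd (S k)).
    assert (0 <= fejer_sum k x) by (apply IH, Rinv_0_lt_compat, lt_0_INR; lia). lra.
  - assert (Hp : 0 < 1 + cos x) by (pose proof (COS_bound x); lra).
    apply Rmult_le_reg_r with (1 + cos x); [ exact Hp | ].
    rewrite Rmult_0_l, fejer_mul. apply Rmult_le_pos; [ lra | ].
    assert (H1 : Rabs ((-1) ^ k * cos (INR (S k) * x)) <= 1).
    { rewrite Rabs_mult, pow_1_abs, Rmult_1_l. apply Rabs_le, COS_bound. }
    apply Rabs_le_between in H1. lra.
Qed.

Lemma fejer_mul_trig1 k : trig1 (fun x => fejer k x * (1 + cos x)) (/ INR (S k)).
Proof.
  eapply trig1_ext; [ | | apply (trig1_scal (/ INR (S k))), (trig1_plus (fun _ => 1)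
    (fun x => (-1) ^ k * cos (INR (S k) * x))); [ apply trig1_const |
    apply (trig1_scal ((-1) ^ k)), (trig1_cos (S k)); lia ] ].
  - intro x. rewrite fejer_mul. reflexivity.
  - ring.
Qed.

Lemma prod_primes_replace (g : nat -> R) (h : R) q P : isprime q = true ->
  prod_primes (fun p => if (p =? q)%nat then g p * h else g p) P
  = prod_primes g P * (if (q <? P)%nat then h else 1).
Proof.
  intros Hq. induction P as [ | P IH ]; [ simpl; ring | ].
  simpl prod_primes. destruct (Nat.eqb_spec P q) as [ -> | Hne ].
  - rewrite Hq, IH. destruct (Nat.ltb_spec q q); [ lia | ].
    destruct (Nat.ltb_spec q (S q)); [ ring | lia ].
  - rewrite IH. destruct (Nat.ltb_spec q P), (Nat.ltb_spec q (S P)); try lia;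
      destruct (isprime P); ring.
Qed.

Lemma prod_primes_1 P : prod_primes (fun _ => 1) P = 1.
Proof. induction P as [ | P IH ]; simpl; [ ring | destruct (isprime P); lra ]. Qed.

(* Weighting by a product of Fejer kernels makes the mean of every
   [1 + cos (t ln q)] equal to [1 / (k + 1)]. *)
Lemma kronecker_primes (P : nat) (d : R) : 0 < d ->
  exists t, forall p, isprime p = true -> (p < P)%nat -> 1 + cos (t * ln (INR p)) < d.
Proof.
  intros Hd. apply NNPP. intro Hno.
  assert (Hbad : forall t, exists p, isprime p = true /\ (p < P)%nat
    /\ d <= 1 + cos (t * ln (INR p))).
  { intro t. apply NNPP. intro Hn. apply Hno. exists t.
    intros p Hp HpP. apply Rnot_le_lt. intro Hle. apply Hn. exists p. tauto. }
  clear Hno.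
  (* [k + 1 > P / d], so that at most [P] means, each at most [1 / (k + 1)], add up to less than
     [d]. *)
  destruct (nfloor_ex (INR P / d)) as [k [_ Hk]].
  { apply Rdiv_le_0_compat; [ apply pos_INR | exact Hd ]. }
  set (W := fun t => prod_primes (fun p => fejer k (t * ln (INR p))) P).
  set (e := fun q t => if isprime q then 1 + cos (t * ln (INR q)) else 0).
  assert (HW0 : forall t, 0 <= W t).
  { intro t. apply prod_primes_ge0. intros; apply fejer_ge0. }
  assert (He0 : forall q t, 0 <= e q t).
  { intros q t. unfold e. destruct (isprime q); [ | lra ].
    pose proof (COS_bound (t * ln (INR q))). lra. }
  assert (HW : has_mean W 1).
  { rewrite <- (prod_primes_1 P). apply (trig_has_mean P).
    apply (trig_prod_primes (fun _ => fejer k) (fun _ => 1)). intros _. apply fejer_trig1. }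
  assert (HWe : forall q, (q < P)%nat ->
    exists m, m <= / INR (S k) /\ has_mean (fun t => W t * e q t) m).
  { intros q HqP. destruct (isprime q) eqn:Eq.
    - exists (/ INR (S k)). split; [ lra | ].
      apply has_mean_ext with (fun t => prod_primes
        (fun p => (if (p =? q)%nat then fun x => fejer k x * (1 + cos x) else fejer k)
          (t * ln (INR p))) P).
      + intro t. unfold W, e. rewrite Eq.
        rewrite (prod_primes_ext _ (fun p => if (p =? q)%nat
          then fejer k (t * ln (INR p)) * (1 + cos (t * ln (INR q)))
          else fejer k (t * ln (INR p)))).
        * rewrite prod_primes_replace by exact Eq.
          destruct (Nat.ltb_spec q P); [ reflexivity | lia ].
        * intros p _. destruct (Nat.eqb_spec p q) as [ -> | ]; reflexivity.
      + replace (/ INR (S k)) with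
          (prod_primes (fun p => if (p =? q)%nat then 1 * / INR (S k) else 1) P).
        * apply (trig_has_mean P).
          apply (trig_prod_primes (fun p => if (p =? q)%nat
             then fun x => fejer k x * (1 + cos x) else fejer k)
             (fun p => if (p =? q)%nat then 1 * / INR (S k) else 1)).
          intro p. destruct (p =? q)%nat; [ | apply fejer_trig1 ].
          rewrite Rmult_1_l. apply fejer_mul_trig1.
        * rewrite (prod_primes_replace (fun _ => 1)) by exact Eq. rewrite prod_primes_1.
          destruct (Nat.ltb_spec q P); [ ring | lia ].
    - exists 0. split; [ left; apply Rinv_0_lt_compat, lt_0_INR; lia | ].
      apply has_mean_ext with (fun _ => 0); [ | apply has_mean_const ].
      intro t. unfold e. rewrite Eq. ring. }
  (* The total defect over the primes. If every [t] fails at some prime, it is at least [d]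
     everywhere, although its weighted mean is below [d]. *)
  set (sig := fix sig Q t := match Q with O => 0 | S q => sig q t + e q t end).
  assert (Hsig : forall Q, (Q <= P)%nat ->
    exists m, m <= INR Q * / INR (S k) /\ has_mean (fun t => W t * sig Q t) m).
  { induction Q as [ | Q IH ]; intros HQ.
    - exists 0. split; [ simpl; lra | ].
      apply has_mean_ext with (fun _ => 0); [ | apply has_mean_const ].
      intro t. simpl. ring.
    - destruct IH as [m [Hm HmW]]; [ lia | ]. destruct (HWe Q) as [m' [Hm' HmW']]; [ lia | ].
      exists (m + m'). split; [ rewrite S_INR; lra | ].
      eapply has_mean_ext; [ | apply (has_mean_plus _ _ _ _ HmW HmW') ].
      intro t. simpl. ring. }
  assert (Hbig : forall t, d <= sig P t).
  { intro t. destruct (Hbad t) as [p [Hp [HpP Hdp]]].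
    assert (Hs0 : forall Q, 0 <= sig Q t).
    { induction Q as [ | Q IH ]; simpl; [ lra | ]. specialize (He0 Q t). lra. }
    clear - Hp HpP Hdp He0 Hs0. induction P as [ | Q IH ]; [ lia | ]. simpl.
    destruct (Nat.eq_dec p Q) as [ -> | Hne ].
    - specialize (Hs0 Q). replace (e Q t) with (1 + cos (t * ln (INR Q))); [ lra | ].
      unfold e. rewrite Hp. reflexivity.
    - assert (d <= sig Q t) by (apply IH; lia). specialize (He0 Q t). lra. }
  destruct (Hsig P (le_n P)) as [m [Hm HmW]].
  (* The function [W (sig P - d)] is non-negative, and its mean is [m - d] because [W] has mean
     1. *)
  pose proof (has_mean_plus _ _ _ _ HmW (has_mean_scal (- d) _ _ HW)) as H.
  apply has_mean_ge0 in H.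
  - assert (Hpos : 0 < INR (S k)) by (apply lt_0_INR; lia).
    assert (INR P < d * INR (S k)).
    { rewrite S_INR. apply Rmult_lt_reg_r with (/ d); [ apply Rinv_0_lt_compat, Hd | ].
      replace (d * (INR k + 1) * / d) with (INR k + 1) by (field; lra). exact Hk. }
    assert (INR P * / INR (S k) < d); [ | lra ].
    apply Rmult_lt_reg_r with (INR (S k)); [ exact Hpos | ].
    rewrite Rmult_assoc, Rinv_l, Rmult_1_r by lra. exact H0.
  - intro t. specialize (Hbig t). specialize (HW0 t). nra.
Qed.

Lemma cpow_Ci_mul t n : (0 < n)%nat ->
  cpow (Ci * RtoC t) n = (cos (t * ln (INR n)), - sin (t * ln (INR n))).
Proof.
  intros Hn. destruct n as [ | n ]; [ lia | ]. unfold cpow, Cexp.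
  set (l := ln (INR (S n))).
  replace (Re (- (Ci * t) * l)) with 0 by (unfold Re; simpl; ring).
  replace (Im (- (Ci * t) * l)) with (- (t * l)) by (unfold Im; simpl; ring).
  rewrite exp_0, cos_neg, sin_neg. f_equal; ring.
Qed.

Lemma Cmod_cpow_Ci_le t n : Cmod (cpow (Ci * RtoC t) n) <= 1.
Proof.
  rewrite Cmod_cpow. replace (Re (Ci * t)) with 0 by (unfold Re; simpl; ring).
  destruct n as [ | n ]; simpl; [ lra | ].
  rewrite Ropp_0, Rmult_0_l, exp_0. lra.
Qed.

(** Both functions are completely multiplicative and bounded by 1, so each prime factor of [n] adds
    an error of at most [d]; the number of prime factors is bounded crudely by [n]. *)
Lemma cpow_near_liouville (N : nat) (e : R) : 0 < e ->
  exists t, forall n, (n <= N)%nat -> Cmod (cpow (Ci * RtoC t) n - RtoC (liouville n)) <= e.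
Proof.
  intros He. set (d := e / (INR N + 1)).
  assert (HN : 0 < INR N + 1) by (pose proof (pos_INR N); lra).
  assert (Hd : 0 < d) by (apply Rdiv_lt_0_compat; assumption).
  (* The tolerance comes from [|p^{-it} + 1|^2 = 2 (1 + cos (t ln p))]. *)
  destruct (kronecker_primes (S N) (d ^ 2 / 2)) as [t Ht]; [ nra | ].
  exists t.
  assert (Hp : forall p, isprime p = true -> (p <= N)%nat ->
    Cmod (cpow (Ci * RtoC t) p + 1) <= d).
  { intros p Hp HpN. rewrite cpow_Ci_mul by (apply isprime_ge2 in Hp; lia).
    specialize (Ht p Hp ltac:(lia)). set (x := t * ln (INR p)) in *.
    replace ((cos x, (- sin x)%R) + 1)%C with ((cos x + 1, - sin x)%R : C)
      by (unfold Cplus, RtoC; simpl; f_equal; ring).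
    rewrite Cmod_eq, <- (sqrt_pow2 d) by lra. apply sqrt_le_1_alt.
    pose proof (sin2_cos2 x) as H. unfold Rsqr in H. nra. }
  assert (H : forall n, (n <= N)%nat ->
    Cmod (cpow (Ci * RtoC t) n - RtoC (liouville n)) <= INR n * d).
  { induction n as [ n IH ] using lt_wf_ind. intros Hn.
    destruct n as [ | [ | n ] ].
    - simpl. replace (RtoC 0 - RtoC 0)%C with (RtoC 0) by ring. rewrite Cmod_0. lra.
    - rewrite cpow_1, liouville1. replace (RtoC 1 - RtoC 1)%C with (RtoC 0) by ring.
      rewrite Cmod_0. simpl. lra.
    - destruct (prime_divisor (S (S n)) ltac:(lia)) as [p [m [Hpp E Hm0 Hmn]]].
      pose proof (isprime_ge2 p Hpp) as Hp2.
      assert (HpN : (p <= N)%nat) by nia.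
      rewrite E, cpow_mul, liouville_mul, (liouville_prime p Hpp), <- E.
      set (z := cpow (Ci * RtoC t) p) in *. set (w := cpow (Ci * RtoC t) m).
      replace (z * w - RtoC (-1 * liouville m))%C
        with ((z + 1) * w + - (w - RtoC (liouville m)))%C
        by (rewrite RtoC_mult; change (RtoC (-1)) with (RtoC (- (1))); rewrite RtoC_opp; ring).
      eapply Rle_trans; [ apply Cmod_triangle | ]. rewrite Cmod_opp, Cmod_mult.
      specialize (IH m Hmn ltac:(lia)). specialize (Hp p Hpp HpN). fold z in Hp.
      fold w in IH. pose proof (Cmod_cpow_Ci_le t m) as Hw. fold w in Hw.
      pose proof (Cmod_ge_0 (z + 1)). pose proof (Cmod_ge_0 w).
      assert (INR m + 1 <= INR (S (S n))) by (rewrite <- S_INR; apply le_INR; lia).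
      apply Rle_trans with (d * 1 + INR m * d); [ | nra ].
      apply Rplus_le_compat; [ apply Rmult_le_compat | ]; assumption. }
  intros n Hn. eapply Rle_trans; [ apply H, Hn | ].
  apply le_INR in Hn. replace e with ((INR N + 1) * d) by (unfold d; field; lra). nra.
Qed.

(** * Values of zeta near the Liouville series *)

(** Places [L] and the vertical translates of zeta in one family, where they differ only in their
    bounded coefficients. *)
Definition dseries (w : nat -> C) (s : C) : C := CSeries (fun n => (w n * cpow s n)%C).

Lemma abs_summable_dseries w K s : (forall n, Cmod (w n) <= K) -> 1 < Re s ->
  abs_summable (fun n => (w n * cpow s n)%C).
Proof.
  intros Hw Hs. apply abs_summable_le with (fun n => K * rpow (Re s) n).
  - intro n. rewrite Cmod_mult, Cmod_cpow.
    apply Rmult_le_compat_r; [ apply rpow_ge0 | apply Hw ].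
  - apply (ex_series_scal_l K (rpow (Re s))). apply ex_series_rpow, Hs.
Qed.

(** The bound [K] gives summability, while the constant [Series b] may follow the actual size of the
    coefficients: it becomes small for the difference of two close coefficient sequences. *)
Lemma dseries_lipschitz w K s s' x b : 1 < x -> x <= Re s -> x <= Re s' ->
  (forall n, Cmod (w n) <= K) ->
  (forall n, Cmod (w n) * (ln (INR n) * rpow x n) <= b n) -> ex_series b ->
  Cmod (dseries w s - dseries w s') <= Series b * Cmod (s - s').
Proof.
  intros Hx Hs Hs' HK Hb Hex. unfold dseries.
  rewrite <- CSeries_minus by (eapply abs_summable_dseries; [ exact HK | lra ]).
  rewrite <- Series_scal_r. apply Cmod_CSeries_le.
  - intro n. replace (w n * cpow s n - w n * cpow s' n)%C
      with (w n * (cpow s n - cpow s' n))%C by ring.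
    rewrite Cmod_mult.
    pose proof (cpow_lipschitz s s' x n Hs Hs') as H.
    pose proof (Cmod_ge_0 (w n)). pose proof (Cmod_ge_0 (s - s')). specialize (Hb n).
    apply Rle_trans with (Cmod (w n) * (ln (INR n) * rpow x n * Cmod (s - s')));
      [ apply Rmult_le_compat_l; assumption | ].
    rewrite <- Rmult_assoc. apply Rmult_le_compat_r; assumption.
  - apply (ex_series_scal_r (Cmod (s - s')) b), Hex.
Qed.

Lemma Cmod_liouville_le n : Cmod (RtoC (liouville n)) <= 1.
Proof. rewrite Cmod_R. apply Rabs_liouville_le. Qed.

(** The termwise derivative of [lseries]. *)
Definition lderiv (x : R) : R := - Series (fun n => liouville n * (ln (INR n) * rpow x n)).

Definition ln2_bound (x : R) : R := Series (fun n => ln (INR n) ^ 2 * rpow x n).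

(** Sum of [cpow_linearize] over [n]. The slope is frozen at [x0] while both points vary, as a
    Newton map with constant slope requires. *)
Lemma dseries_liouville_linearize x0 s s' x r : 1 < x -> x <= x0 -> x <= Re s -> x <= Re s' ->
  Cmod (s - RtoC x0) <= r -> Cmod (s' - RtoC x0) <= r ->
  Cmod (dseries (fun n => RtoC (liouville n)) s - dseries (fun n => RtoC (liouville n)) s'
        - RtoC (lderiv x0) * (s - s'))
    <= ln2_bound x * r * Cmod (s - s').
Proof.
  intros Hx Hx0 Hs Hs' Hr Hr'.
  assert (Hl : abs_summable (fun n => RtoC (liouville n * (ln (INR n) * rpow x0 n)))).
  { apply abs_summable_le with (fun n => ln (INR n) ^ 1 * rpow x0 n);
      [ | apply ex_series_ln_rpow; lra ].
    intro n. rewrite Cmod_R, Rabs_mult, pow_1.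
    assert (0 <= ln (INR n) * rpow x0 n)
      by (apply Rmult_le_pos; [ apply ln_INR_ge0 | apply rpow_ge0 ]).
    rewrite (Rabs_pos_eq (_ * _)) by assumption. pose proof (Rabs_liouville_le n). nra. }
  unfold lderiv. rewrite RtoC_opp, <- CSeries_RtoC.
  match goal with |- Cmod (?a - ?b - - ?c * ?d) <= _ =>
    replace (a - b - - c * d)%C with (a - b - (- d) * c)%C by ring end.
  rewrite <- CSeries_scal by exact Hl. unfold dseries.
  assert (H1 : forall z, x <= Re z -> abs_summable (fun n => (liouville n * cpow z n)%C)).
  { intros z Hz. eapply abs_summable_dseries; [ apply Cmod_liouville_le | lra ]. }
  rewrite <- CSeries_minus by auto. rewrite <- CSeries_minus.
  - unfold ln2_bound. rewrite Rmult_assoc, <- Series_scal_r. apply Cmod_CSeries_le.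
    + intro n. rewrite !RtoC_mult, <- cpow_RtoC.
      match goal with |- Cmod ?z <= _ => replace z with (RtoC (liouville n) *
        (cpow s n - cpow s' n + (s - s') * (RtoC (ln (INR n)) * cpow (RtoC x0) n)))%C by ring end.
      rewrite Cmod_mult.
      pose proof (cpow_linearize (RtoC x0) s s' x r n Hx0 Hs Hs' Hr Hr') as H.
      pose proof (Cmod_liouville_le n).
      match type of H with ?u <= _ => pose proof (Cmod_ge_0 (cpow s n - cpow s' n
        + (s - s') * (RtoC (ln (INR n)) * cpow (RtoC x0) n))) as Hu; set (v := u) in * end.
      pose proof (Cmod_ge_0 (RtoC (liouville n))). nra.
    + apply (ex_series_scal_r (r * Cmod (s - s')) (fun n => ln (INR n) ^ 2 * rpow x n)).
      apply ex_series_ln_rpow, Hx.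
  - apply abs_summable_le with (fun n => Cmod (liouville n * cpow s n)
      + Cmod (liouville n * cpow s' n)).
    + intro n. eapply Rle_trans; [ apply Cmod_triangle | ]. rewrite Cmod_opp. lra.
    + apply (ex_series_plus (fun n => Cmod (liouville n * cpow s n))
        (fun n => Cmod (liouville n * cpow s' n))); apply H1; assumption.
  - apply abs_summable_le with (fun n => Cmod (- (s - s')) *
      Cmod (RtoC (liouville n * (ln (INR n) * rpow x0 n)))).
    + intro n. rewrite Cmod_mult. lra.
    + apply (ex_series_scal_l (Cmod (- (s - s')))
        (fun n => Cmod (RtoC (liouville n * (ln (INR n) * rpow x0 n))))), Hl.
Qed.

Lemma dseries_liouville_RtoC x : dseries (fun n => RtoC (liouville n)) (RtoC x) = RtoC (lseries x).
Proof.
  unfold dseries, lseries. rewrite <- CSeries_RtoC. apply CSeries_ext.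
  intro n. rewrite cpow_RtoC, RtoC_mult. reflexivity.
Qed.

(** Beyond [N] the trivial bound 2 meets a tail of at most [e / 4]; below [N] the error [d] per term
    costs at most [d * Series b <= e / 2]. *)
Lemma liouville_approx (b : nat -> R) (e : R) : (forall n, 0 <= b n) -> ex_series b -> 0 < e ->
  exists t, Series (fun n => Cmod (cpow (Ci * RtoC t) n - RtoC (liouville n)) * b n) <= e.
Proof.
  intros Hb Hex He.
  assert (HS : 0 <= Series b).
  { rewrite <- Series_zero. apply Series_le; [ | exact Hex ]. intro n. specialize (Hb n). lra. }
  assert (Htail : exists N, Series (tail N b) <= e / 4).
  { pose proof (is_lim_seq_tail b Hex) as H. apply is_lim_seq_spec in H.
    destruct (H (mkposreal (e / 4) ltac:(lra))) as [N HN]. exists N.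
    rewrite Series_tail. specialize (HN N (le_n N)). simpl in HN.
    apply Rabs_def2 in HN. lra. }
  destruct Htail as [N HN].
  set (d := e / (2 * (1 + Series b))).
  assert (Hd : 0 < d) by (apply Rdiv_lt_0_compat; lra).
  destruct (cpow_near_liouville N d Hd) as [t Ht]. exists t.
  apply Rle_trans with (Series (fun n => d * b n + 2 * tail N b n)).
  - apply Series_le.
    + intro n. specialize (Hb n).
      pose proof (Cmod_ge_0 (cpow (Ci * RtoC t) n - RtoC (liouville n))) as H0.
      split; [ apply Rmult_le_pos; assumption | ].
      unfold tail. destruct (Nat.ltb_spec n N) as [ Hn | Hn ].
      * specialize (Ht n ltac:(lia)). nra.
      * assert (Cmod (cpow (Ci * RtoC t) n - RtoC (liouville n)) <= 2).
        { eapply Rle_trans; [ apply Cmod_triangle | ]. rewrite Cmod_opp.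
          pose proof (Cmod_cpow_Ci_le t n). pose proof (Cmod_liouville_le n). lra. }
        nra.
    + apply (ex_series_plus (fun n => d * b n) (fun n => 2 * tail N b n)).
      * apply (ex_series_scal_l d b), Hex.
      * apply (ex_series_scal_l 2 (tail N b)), ex_series_tail; assumption.
  - rewrite Series_plus, !Series_scal_l.
    + assert (d * (2 * (1 + Series b)) = e) by (unfold d; field; lra). nra.
    + apply (ex_series_scal_l d b), Hex.
    + apply (ex_series_scal_l 2 (tail N b)), ex_series_tail; assumption.
Qed.

Lemma Cmod_le_Re_Im (z : C) : Cmod z <= Rabs (Re z) + Rabs (Im z).
Proof.
  destruct z as [a b]. unfold Re, Im; simpl.
  replace ((a, b) : C) with (RtoC a + Ci * RtoC b)%C
    by (unfold Cplus, Cmult, RtoC, Ci; simpl; f_equal; ring).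
  eapply Rle_trans; [ apply Cmod_triangle | ].
  rewrite Cmod_mult, Cmod_Ci, !Cmod_R. lra.
Qed.

Lemma Series_half_geom r : ex_series (fun n => r / 2 * (/ 2) ^ n) /\
  Series (fun n => r / 2 * (/ 2) ^ n) = r.
Proof.
  assert (H : Rabs (/ 2) < 1) by (rewrite Rabs_pos_eq; lra). split.
  - apply (ex_series_scal_l (r / 2) (fun n => (/ 2) ^ n)), ex_series_geom, H.
  - rewrite Series_scal_l, Series_geom by exact H. field.
Qed.

(** Banach's theorem on a closed disc that [T] need not be known to preserve: a first step of at
    most [r / 2] and ratio [1 / 2] keep all iterates within [r] of [z0]. *)
Lemma contraction_fixed_point (T : C -> C) (z0 : C) (r : R) :
  (forall z w, Cmod (z - z0) <= r -> Cmod (w - z0) <= r ->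
     Cmod (T z - T w) <= / 2 * Cmod (z - w)) ->
  Cmod (T z0 - z0) <= r / 2 ->
  exists z, Cmod (z - z0) <= r /\ T z = z.
Proof.
  intros HT H0.
  assert (Hr : 0 <= r) by (pose proof (Cmod_ge_0 (T z0 - z0)); lra).
  assert (Hz0 : Cmod (z0 - z0) <= r).
  { replace (z0 - z0)%C with (RtoC 0) by ring. rewrite Cmod_0. exact Hr. }
  set (z := fun n => Nat.iter n T z0).
  assert (HzS : forall n, z (S n) = T (z n)) by reflexivity.
  assert (Hball : forall n, Cmod (z n - z0) <= r).
  { induction n as [ | n IH ]; [ exact Hz0 | ]. rewrite HzS.
    replace (T (z n) - z0)%C with ((T (z n) - T z0) + (T z0 - z0))%C by ring.
    eapply Rle_trans; [ apply Cmod_triangle | ]. specialize (HT _ _ IH Hz0). lra. }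
  set (u := fun n => (z (S n) - z n)%C).
  assert (Hu : forall n, Cmod (u n) <= r / 2 * (/ 2) ^ n).
  { induction n as [ | n IH ].
    - simpl. rewrite Rmult_1_r. exact H0.
    - eapply Rle_trans; [ apply (HT (z (S n)) (z n)); apply Hball | ].
      fold (u n). rewrite <- tech_pow_Rmult. lra. }
  destruct (Series_half_geom r) as [Hex Hsum].
  pose proof (abs_summable_le u _ Hu Hex) as Habs.
  assert (Hpart : forall n, sum_n (fun k => Re (u k)) n = Re (z (S n)) - Re z0
    /\ sum_n (fun k => Im (u k)) n = Im (z (S n)) - Im z0).
  { induction n as [ | n [IH1 IH2] ].
    - rewrite !sum_O. unfold u, Re, Im. simpl. split; ring.
    - rewrite !sum_Sn, IH1, IH2. unfold u at 1 2. unfold plus, Re, Im. simpl. split; ring. }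
  (* The limit is the starting point plus the absolutely convergent series of increments. *)
  set (l := (z0 + CSeries u)%C).
  assert (HRe : is_lim_seq (fun n => Re (z (S n))) (Re l)).
  { apply is_lim_seq_ext with (fun n => Re z0 + sum_n (fun k => Re (u k)) n).
    - intro n. rewrite (proj1 (Hpart n)). ring.
    - apply is_lim_seq_plus'; [ apply is_lim_seq_const | ].
      apply (Series_correct (fun k => Re (u k))), abs_summable_Re, Habs. }
  assert (HIm : is_lim_seq (fun n => Im (z (S n))) (Im l)).
  { apply is_lim_seq_ext with (fun n => Im z0 + sum_n (fun k => Im (u k)) n).
    - intro n. rewrite (proj2 (Hpart n)). ring.
    - apply is_lim_seq_plus'; [ apply is_lim_seq_const | ].
      apply (Series_correct (fun k => Im (u k))), abs_summable_Im, Habs. }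
  assert (Hl : Cmod (l - z0) <= r).
  { unfold l. replace (z0 + CSeries u - z0)%C with (CSeries u) by ring.
    rewrite <- Hsum at 1. apply Cmod_CSeries_le; assumption. }
  exists l. split; [ exact Hl | ].
  assert (Hlim : is_lim_seq (fun n => Cmod (z (S n) - l)) 0).
  { apply is_lim_seq_le_le with (u := fun _ => 0)
      (w := fun n => Rabs (Re (z (S n)) - Re l) + Rabs (Im (z (S n)) - Im l)).
    - intro n. split; [ apply Cmod_ge_0 | ]. apply (Cmod_le_Re_Im (z (S n) - l)).
    - apply is_lim_seq_const.
    - replace (Finite 0) with (Finite (0 + 0)) by (f_equal; ring).
      apply is_lim_seq_plus'; apply (proj1 (is_lim_seq_abs_0 _)).
      + replace (Finite 0) with (Finite (Re l - Re l)) by (f_equal; ring).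
        apply is_lim_seq_minus'; [ exact HRe | apply is_lim_seq_const ].
      + replace (Finite 0) with (Finite (Im l - Im l)) by (f_equal; ring).
        apply is_lim_seq_minus'; [ exact HIm | apply is_lim_seq_const ]. }
  assert (H : Rbar_le (Cmod (T l - l)) 0).
  { apply is_lim_seq_le with (u := fun _ => Cmod (T l - l))
      (v := fun n => / 2 * Cmod (z (S n) - l) + Cmod (z (S (S n)) - l)).
    - intro n. replace (T l - l)%C with (- (T (z (S n)) - T l) + (z (S (S n)) - l))%C
        by (rewrite (HzS (S n)); ring).
      eapply Rle_trans; [ apply Cmod_triangle | ]. rewrite Cmod_opp.
      apply Rplus_le_compat_r, HT; [ apply Hball | exact Hl ].
    - apply is_lim_seq_const.
    - replace (Finite 0) with (Finite (/ 2 * 0 + 0)) by (f_equal; ring).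
      apply is_lim_seq_plus'.
      + apply (is_lim_seq_scal_l _ (/ 2) 0 Hlim).
      + apply (is_lim_seq_incr_1 (fun n => Cmod (z (S n) - l))), Hlim. }
  simpl in H.
  assert (E : (T l - l)%C = RtoC 0) by (apply Cmod_eq_0; pose proof (Cmod_ge_0 (T l - l)); lra).
  replace (T l) with (T l - l + l)%C by ring. rewrite E. ring.
Qed.

Lemma ln2_bound_ge0 x : 1 < x -> 0 <= ln2_bound x.
Proof.
  intros Hx. rewrite <- Series_zero. apply Series_le; [ | apply ex_series_ln_rpow, Hx ].
  intro n. split; [ lra | ].
  apply Rmult_le_pos; [ apply pow_le, ln_INR_ge0 | apply rpow_ge0 ].
Qed.

(** The growth of [L] over a small step [h] is at least [k h] by [lseries_growth] and at most [L' h]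
    plus a quadratic remainder. With the remainder at most [k h / 2], this gives [L' >= k / 2]. *)
Lemma lderiv_pos x : 1 < x -> 0 < lderiv x.
Proof.
  intros Hx. pose proof (ln2_bound_ge0 x Hx) as HB.
  assert (Hln : 0 < ln 2 <= 1).
  { split; [ rewrite <- ln_1; apply ln_increasing; lra | ].
    pose proof (ln_le_sub1 2 ltac:(lra)). lra. }
  pose proof (lseries_pos x Hx) as Hf. pose proof (rpow_gt0 x 2 ltac:(lia)) as Hx2.
  (* One factor [1 / 2] comes from [1 - 2^{-h} >= h ln 2 / 2], the other from
     [1 + 2^{-(x+h)} < 2]. *)
  set (k := lseries x * rpow x 2 * ln 2 / 4).
  assert (Hk : 0 < k).
  { unfold k. apply Rdiv_lt_0_compat; [ | lra ].
    repeat apply Rmult_lt_0_compat; lra. }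
  set (h := Rmin 1 (k / 2 / (1 + ln2_bound x))).
  assert (Hh : 0 < h <= 1).
  { unfold h. split; [ apply Rmin_glb_lt; [ lra | apply Rdiv_lt_0_compat; lra ] | apply Rmin_l ]. }
  assert (HhB : ln2_bound x * h <= k / 2).
  { assert (h * (1 + ln2_bound x) <= k / 2); [ | nra ].
    apply Rle_trans with (k / 2 / (1 + ln2_bound x) * (1 + ln2_bound x)).
    - apply Rmult_le_compat_r; [ lra | apply Rmin_r ].
    - right. field. lra. }
  assert (Hup : lseries (x + h) - lseries x <= lderiv x * h + ln2_bound x * h * h).
  { pose proof (dseries_liouville_linearize x (RtoC (x + h)) (RtoC x) x h Hx) as H.
    rewrite !dseries_liouville_RtoC, <- !RtoC_minus, <- RtoC_mult, <- RtoC_minus, !Cmod_R in H.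
    replace (x + h - x) with h in H by ring.
    replace (x - x) with 0 in H by ring. rewrite Rabs_R0, (Rabs_pos_eq h) in H by lra.
    specialize (H ltac:(lra) ltac:(simpl; lra) ltac:(simpl; lra) ltac:(lra) ltac:(lra)).
    apply Rabs_le_between in H. lra. }
  pose proof (lseries_growth x (x + h) Hx ltac:(lra)) as Hlow.
  assert (Hy : rpow (x + h) 2 <= rpow x 2 * (1 - h * ln 2 / 2)).
  { rewrite rpow_plus. apply Rmult_le_compat_l; [ lra | ].
    unfold rpow. replace (INR 2) with 2 by (simpl; ring).
    replace (- h * ln 2) with (- (h * ln 2)) by ring. rewrite exp_Ropp.
    set (v := h * ln 2). assert (Hv : 0 < v <= 1) by (unfold v; nra).
    (* For [0 <= v <= 1], [exp (- v) <= 1 / (1 + v) <= 1 - v / 2]. *)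
    apply Rle_trans with (/ (1 + v)).
    - apply Rinv_le_contravar; [ lra | apply exp_ineq1_le ].
    - apply Rmult_le_reg_l with (1 + v); [ lra | ]. rewrite Rinv_r by lra. nra. }
  pose proof (rpow_gt0 (x + h) 2 ltac:(lia)) as Hy0.
  assert (Hy1 : rpow (x + h) 2 < 1) by (apply rpow_lt1; [ lra | lia ]).
  assert (Hgap : k * h <= lseries (x + h) - lseries x).
  { assert (A1 : lseries x * (rpow x 2 * (h * ln 2 / 2))
      <= lseries x * (rpow x 2 - rpow (x + h) 2)) by (apply Rmult_le_compat_l; lra).
    assert (A2 : lseries x * (rpow x 2 - rpow (x + h) 2)
      <= (lseries (x + h) - lseries x) * (1 + rpow (x + h) 2)) by lra.
    assert (A3 : 2 * (k * h) = lseries x * (rpow x 2 * (h * ln 2 / 2))) by (unfold k; field).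
    assert (0 < k * h) by (apply Rmult_lt_0_compat; lra).
    nra. }
  apply Rmult_lt_reg_r with h; [ lra | ]. nra.
Qed.

Lemma zeta_shift_dseries s t : 1 < Re s ->
  zeta (s + Ci * RtoC t) = dseries (cpow (Ci * RtoC t)) s.
Proof.
  intros Hs. rewrite zeta_CSeries by (unfold Re in *; simpl; lra).
  apply CSeries_ext. intro n. rewrite cpow_plus. ring.
Qed.

Lemma dseries_minus w v s : (forall n, Cmod (w n) <= 1) -> (forall n, Cmod (v n) <= 1) ->
  1 < Re s -> dseries (fun n => (w n - v n)%C) s = (dseries w s - dseries v s)%C.
Proof.
  intros Hw Hv Hs. unfold dseries. rewrite <- CSeries_minus;
    [ | eapply abs_summable_dseries; eassumption .. ].
  apply CSeries_ext. intro n. ring.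
Qed.

(* Since the derivative of the Liouville series does not vanish, Newton's map
   for a vertical translate of zeta close to it is a contraction. *)
Lemma zeta_attains_near x0 eta : 1 < x0 -> 0 < eta ->
  exists s, 1 < Re s /\ x0 - eta < Re s /\ zeta s = RtoC (lseries x0).
Proof.
  intros Hx0 Heta. set (x := (1 + x0) / 2).
  assert (Hx : 1 < x) by (unfold x; lra). assert (Hxx : x < x0) by (unfold x; lra).
  pose proof (lderiv_pos x0 Hx0) as Hc. set (c := lderiv x0) in *.
  pose proof (ln2_bound_ge0 x Hx) as HB.
  (* The three bounds keep the real part above [x0 - eta], keep the disc in [Re s >= x > 1], and
     make the linearization error at most [c / 4] per unit of distance. *)
  set (r := Rmin (Rmin (eta / 2) (x0 - x)) (c / 4 / (1 + ln2_bound x))).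
  assert (Hr : 0 < r).
  { unfold r. repeat apply Rmin_glb_lt; try lra. apply Rdiv_lt_0_compat; lra. }
  assert (Hr1 : r <= eta / 2).
  { unfold r. eapply Rle_trans; [ apply Rmin_l | apply Rmin_l ]. }
  assert (Hr2 : r <= x0 - x).
  { unfold r. eapply Rle_trans; [ apply Rmin_l | apply Rmin_r ]. }
  assert (Hr3 : ln2_bound x * r <= c / 4).
  { assert (r * (1 + ln2_bound x) <= c / 4); [ | nra ].
    apply Rle_trans with (c / 4 / (1 + ln2_bound x) * (1 + ln2_bound x)).
    - apply Rmult_le_compat_r; [ lra | apply Rmin_r ].
    - right. field. lra. }
  clearbody r.
  (* One weight dominates both the terms of the series and their Lipschitz constants, so a single
     [t] controls values and difference quotients. *)
  set (b := fun n => rpow x n + ln (INR n) ^ 1 * rpow x n).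
  assert (Hb1 : forall n, rpow x n <= b n /\ ln (INR n) * rpow x n <= b n).
  { intro n. unfold b. rewrite pow_1. pose proof (rpow_ge0 x n).
    assert (0 <= ln (INR n) * rpow x n)
      by (apply Rmult_le_pos; [ apply ln_INR_ge0 | apply rpow_ge0 ]). lra. }
  assert (Hb0 : forall n, 0 <= b n).
  { intro n. specialize (Hb1 n). pose proof (rpow_ge0 x n). lra. }
  assert (Hbex : ex_series b).
  { apply (ex_series_plus (rpow x) (fun n => ln (INR n) ^ 1 * rpow x n)).
    - apply ex_series_rpow, Hx.
    - apply ex_series_ln_rpow, Hx. }
  (* The first bound brings the Lipschitz constant of the map to [(c / 4 + c / 4) / c = 1 / 2]; the
     second keeps the first step below [r / 2]. *)
  set (e := Rmin (c / 4) (c * r / 4)).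
  assert (He : 0 < e).
  { unfold e. apply Rmin_glb_lt; [ lra | ]. apply Rdiv_lt_0_compat; [ | lra ].
    apply Rmult_lt_0_compat; lra. }
  destruct (liouville_approx b e Hb0 Hbex He) as [t Ht].
  set (w := cpow (Ci * RtoC t)) in *. set (lam := fun n => RtoC (liouville n)).
  assert (Hw : forall n, Cmod (w n) <= 1) by (intro; apply Cmod_cpow_Ci_le).
  assert (Hlam : forall n, Cmod (lam n) <= 1) by (intro; apply Cmod_liouville_le).
  assert (Hwl : forall n, Cmod (w n - lam n) <= 2).
  { intro n. eapply Rle_trans; [ apply Cmod_triangle | ]. rewrite Cmod_opp.
    specialize (Hw n). specialize (Hlam n). lra. }
  set (bb := fun n => Cmod (w n - lam n) * b n).
  assert (Hbb : ex_series bb).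
  { apply ex_series_le_abs with (fun n => 2 * b n); [ | apply (ex_series_scal_l 2 b), Hbex ].
    intro n. unfold bb. pose proof (Cmod_ge_0 (w n - lam n)). specialize (Hb0 n).
    rewrite Rabs_pos_eq by (apply Rmult_le_pos; assumption).
    apply Rmult_le_compat_r; [ assumption | apply Hwl ]. }
  change (Series bb <= e) in Ht.
  assert (Hball : forall z, Cmod (z - RtoC x0) <= r -> x0 - r <= Re z).
  { intros z Hz. pose proof (re_le_Cmod (z - RtoC x0)) as H.
    replace (Re (z - RtoC x0)) with (Re z - x0) in H by (unfold Re; simpl; ring).
    assert (H' : Rabs (Re z - x0) <= r) by lra. apply Rabs_le_between in H'. lra. }
  destruct (contraction_fixed_point
    (fun z => (z - (dseries w z - RtoC (lseries x0)) / RtoC c)%C) (RtoC x0) r)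
    as [z [Hz Ez]].
  - intros z z' Hz Hz'. pose proof (Hball z Hz). pose proof (Hball z' Hz').
    pose proof (dseries_liouville_linearize x0 z z' x r Hx ltac:(lra) ltac:(lra) ltac:(lra)
      Hz Hz') as H1. fold lam in H1. fold c in H1.
    pose proof (dseries_lipschitz (fun n => (w n - lam n)%C) 2 z z' x bb Hx
      ltac:(lra) ltac:(lra) Hwl) as H2.
    specialize (H2 ltac:(intro n; unfold bb; apply Rmult_le_compat_l;
      [ apply Cmod_ge_0 | apply Hb1 ]) Hbb).
    rewrite !dseries_minus in H2 by (assumption || lra).
    assert (Hc0 : RtoC c <> RtoC 0) by (intro E; apply RtoC_inj in E; lra).
    (* The linear parts cancel, leaving the linearization error of [L] and the increment of the
       translate minus [L]. *)
    match goal with |- Cmod ?y <= _ => replace y with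
      (- ((dseries lam z - dseries lam z' - RtoC c * (z - z'))
        + (dseries w z - dseries lam z - (dseries w z' - dseries lam z'))) / RtoC c)%C
      by (field; exact Hc0) end.
    rewrite Cmod_div, Cmod_opp, Cmod_R, (Rabs_pos_eq c) by (assumption || lra).
    apply Rmult_le_reg_r with c; [ exact Hc | ]. unfold Rdiv at 1.
    rewrite Rmult_assoc, Rinv_l, Rmult_1_r by lra.
    eapply Rle_trans; [ apply Cmod_triangle | ].
    assert (Series bb <= c / 4) by (eapply Rle_trans; [ exact Ht | apply Rmin_l ]).
    pose proof (Cmod_ge_0 (z - z')). nra.
  - assert (Hc0 : RtoC c <> RtoC 0) by (intro E; apply RtoC_inj in E; lra).
    match goal with |- Cmod ?y <= _ => replace y with
      (- (dseries w (RtoC x0) - RtoC (lseries x0)) / RtoC c)%C by (field; exact Hc0) end.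
    rewrite <- dseries_liouville_RtoC. fold lam.
    rewrite <- dseries_minus by assumption.
    rewrite Cmod_div, Cmod_opp, Cmod_R, (Rabs_pos_eq c) by (assumption || lra).
    apply Rmult_le_reg_r with c; [ exact Hc | ]. unfold Rdiv at 1.
    rewrite Rmult_assoc, Rinv_l, Rmult_1_r by lra.
    apply Rle_trans with (Series bb).
    + apply Cmod_CSeries_le; [ | exact Hbb ]. intro n. rewrite Cmod_mult.
      apply Rmult_le_compat_l; [ apply Cmod_ge_0 | ].
      rewrite cpow_RtoC, Cmod_R, Rabs_pos_eq by apply rpow_ge0.
      eapply Rle_trans; [ apply (rpow_le x x0); lra | apply Hb1 ].
    + assert (e <= c * r / 4) by apply Rmin_r. nra.
  - pose proof (Hball z Hz) as HRe.
    exists (z + Ci * RtoC t)%C.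
    assert (E : Re (z + Ci * RtoC t) = Re z) by (unfold Re; simpl; ring).
    rewrite E. split; [ lra | split; [ lra | ] ].
    rewrite zeta_shift_dseries by lra. fold w.
    assert (Hc0 : RtoC c <> RtoC 0) by (intro E'; apply RtoC_inj in E'; lra).
    replace (dseries w z) with
      (RtoC (lseries x0) + RtoC c * (z - (z - (dseries w z - RtoC (lseries x0)) / RtoC c)))%C
      by (field; exact Hc0).
    rewrite Ez. ring.
Qed.

(** * Zeta on the real half-line [x > 1] *)

Lemma sum_n_le_Series (a : nat -> R) N : (forall n, 0 <= a n) -> ex_series a ->
  sum_n a N <= Series a.
Proof.
  intros Ha Hex. apply (is_lim_seq_incr_compare (sum_n a)).
  - apply (Series_correct a Hex).
  - intro n. rewrite sum_Sn. change plus with Rplus. specialize (Ha (S n)). lra.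
Qed.

Lemma rzeta_ge1 x : 1 < x -> 1 <= rzeta x.
Proof.
  intros Hx. rewrite <- (rpow_1 x). eapply Rle_trans;
    [ | apply (sum_n_le_Series (rpow x) 1); [ apply rpow_ge0 | apply ex_series_rpow, Hx ] ].
  rewrite sum_Sn, sum_O. change plus with Rplus. simpl (rpow x 0). lra.
Qed.

Lemma rpow_2_lt x y : x < y -> rpow y 2 < rpow x 2.
Proof.
  intros H. apply exp_increasing.
  assert (0 < ln (INR 2)) by (rewrite <- ln_1; apply ln_increasing; simpl; lra). nra.
Qed.

(** All terms are non-increasing in the exponent, and the term at 2 is strictly decreasing. *)
Lemma rzeta_decr x y : 1 < x -> x < y -> rzeta y < rzeta x.
Proof.
  intros Hx Hxy. enough (0 < rzeta x - rzeta y) by lra. unfold rzeta.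
  assert (Hy : 1 < y) by lra.
  pose proof (ex_series_rpow x Hx) as Ex. pose proof (ex_series_rpow y Hy) as Ey.
  rewrite <- Series_minus by assumption.
  eapply Rlt_le_trans; [ | apply (sum_n_le_Series (fun n => rpow x n - rpow y n) 2) ].
  - rewrite !sum_Sn, sum_O. change plus with Rplus. rewrite !rpow_1.
    change (rpow x 0) with 0. change (rpow y 0) with 0.
    pose proof (rpow_2_lt x y Hxy). lra.
  - intro n. pose proof (rpow_le x y n ltac:(lra)). lra.
  - apply (ex_series_minus (rpow x) (rpow y)); assumption.
Qed.

Lemma rzeta_lipschitz x y z : 1 < x -> x <= y -> x <= z ->
  Rabs (rzeta y - rzeta z) <= Series (fun n => ln (INR n) ^ 1 * rpow x n) * Rabs (y - z).
Proof.
  intros Hx Hy Hz.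
  pose proof (dseries_lipschitz (fun _ => RtoC 1) 1 (RtoC y) (RtoC z) x
    (fun n => ln (INR n) ^ 1 * rpow x n) Hx Hy Hz) as H.
  assert (E : forall v, dseries (fun _ => RtoC 1) (RtoC v) = RtoC (rzeta v)).
  { intro v. unfold dseries, rzeta. rewrite <- CSeries_RtoC. apply CSeries_ext.
    intro n. rewrite cpow_RtoC. ring. }
  rewrite !E, <- !RtoC_minus, !Cmod_R in H. apply H.
  - intros _. rewrite Rabs_R1. lra.
  - intro n. rewrite Rabs_R1, pow_1. lra.
  - apply ex_series_ln_rpow, Hx.
Qed.

Lemma rzeta_continuous x : 1 < x -> continuity_pt rzeta x.
Proof.
  intros Hx. set (x1 := (1 + x) / 2).
  assert (Hx1 : 1 < x1) by (unfold x1; lra).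
  set (L := Series (fun n => ln (INR n) ^ 1 * rpow x1 n)).
  assert (HL : 0 <= L).
  { unfold L. rewrite <- Series_zero. apply Series_le; [ | apply ex_series_ln_rpow, Hx1 ].
    intro n. split; [ lra | ].
    apply Rmult_le_pos; [ apply pow_le, ln_INR_ge0 | apply rpow_ge0 ]. }
  intros e He. exists (Rmin (x - x1) (e / (1 + L))). split.
  - apply Rmin_glb_lt; [ unfold x1; lra | apply Rdiv_lt_0_compat; lra ].
  - intros y [_ Hy]. simpl in Hy |- *. unfold Rdist in Hy |- *.
    assert (H1 : Rabs (y - x) < x - x1) by (eapply Rlt_le_trans; [ exact Hy | apply Rmin_l ]).
    assert (H2 : Rabs (y - x) < e / (1 + L)) by (eapply Rlt_le_trans; [ exact Hy | apply Rmin_r ]).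
    apply Rabs_def2 in H1.
    eapply Rle_lt_trans; [ apply (rzeta_lipschitz x1); unfold x1 in *; lra | ]. fold L.
    assert (H3 : Rabs (y - x) * (1 + L) < e).
    { apply Rlt_le_trans with (e / (1 + L) * (1 + L)).
      - apply Rmult_lt_compat_r; lra.
      - right. field. lra. }
    pose proof (Rabs_pos (y - x)). nra.
Qed.

Lemma rpow_telescope_upper d n : 0 < d ->
  rpow d (S n) - rpow d (S (S n)) <= d * rpow (1 + d) (S n).
Proof.
  intros Hd. rewrite rpow_plus.
  assert (Hn : 0 < INR (S n)) by (apply lt_0_INR; lia).
  assert (Hn' : 0 < INR (S (S n))) by (apply lt_0_INR; lia).
  pose proof (rpow_1_l (S n) ltac:(lia)) as E1.
  set (v := ln (INR (S (S n))) - ln (INR (S n))).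
  assert (E2 : rpow d (S (S n)) = rpow d (S n) * exp (- d * v)).
  { unfold rpow, v. rewrite <- exp_plus. f_equal. ring. }
  assert (H : v <= / INR (S n)).
  { assert (H0 : 0 < INR (S (S n)) / INR (S n)) by (apply Rdiv_lt_0_compat; assumption).
    pose proof (ln_le_sub1 _ H0) as H. rewrite ln_div in H by assumption. fold v in H.
    replace (INR (S (S n)) / INR (S n) - 1) with (/ INR (S n)) in H; [ exact H | ].
    rewrite (S_INR (S n)). field. lra. }
  rewrite E1, E2.
  pose proof (exp_ineq1_le (- d * v)) as He.
  pose proof (rpow_gt0 d (S n) ltac:(lia)) as Hp.
  assert (1 - exp (- d * v) <= d * / INR (S n)) by nra.
  nra.
Qed.

(** Telescoping gives [1 - (N + 1)^{-d} <= d * rzeta (1 + d)]. Taking [N + 1 >= 2^{1/d}] makes the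
    left side at least [1 / 2], a constant that suffices for divergence at 1. *)
Lemma rzeta_lower d : 0 < d -> / (2 * d) <= rzeta (1 + d).
Proof.
  intros Hd.
  assert (HN : exists N, rpow d (S N) <= / 2).
  { destruct (nfloor_ex (exp (ln 2 / d))) as [N [_ HN]]; [ left; apply exp_pos | ].
    exists N. unfold rpow. rewrite S_INR.
    rewrite <- (exp_ln (/ 2)), ln_Rinv by lra. apply exp_le_compat.
    assert (H : ln 2 / d <= ln (INR N + 1)).
    { rewrite <- (ln_exp (ln 2 / d)). apply ln_le; [ apply exp_pos | lra ]. }
    apply (Rmult_le_compat_l d) in H; [ | lra ].
    replace (d * (ln 2 / d)) with (ln 2) in H by (field; lra). lra. }
  destruct HN as [N HN].
  assert (H : forall n, 1 - rpow d (S n) <= d * sum_n (rpow (1 + d)) n).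
  { induction n as [ | n IH ].
    - rewrite sum_O, rpow_1. simpl. lra.
    - rewrite sum_Sn. change plus with Rplus. rewrite Rmult_plus_distr_l.
      pose proof (rpow_telescope_upper d n Hd). lra. }
  specialize (H N).
  pose proof (sum_n_le_Series (rpow (1 + d)) N (rpow_ge0 _)
    (ex_series_rpow (1 + d) ltac:(lra))) as H'. fold (rzeta (1 + d)) in H'.
  apply Rmult_le_reg_l with (2 * d); [ lra | ]. rewrite Rinv_r by lra. nra.
Qed.

(** For [n >= 2], [n^{-x} <= 2^{-(x-2)} n^{-2}]. *)
Lemma rzeta_upper x : 2 <= x -> rzeta x <= 1 + rpow (x - 2) 2 * rzeta 2.
Proof.
  intros Hx. unfold rzeta. rewrite <- Series_unit_at_1, <- Series_scal_l.
  assert (E1 : ex_series unit_at_1) by apply ex_series_Rabs, ex_series_unit_at_1.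
  assert (E2 : ex_series (fun n => rpow (x - 2) 2 * rpow 2 n))
    by (apply (ex_series_scal_l (rpow (x - 2) 2) (rpow 2)), ex_series_rpow; lra).
  rewrite <- Series_plus by assumption. apply Series_le.
  - intro n. split; [ apply rpow_ge0 | ].
    pose proof (rpow_ge0 2 n) as H2. pose proof (rpow_ge0 (x - 2) 2) as Hx2.
    destruct n as [ | [ | n ] ].
    + simpl. unfold unit_at_1; simpl. lra.
    + rewrite !rpow_1. unfold unit_at_1; simpl Nat.eqb. lra.
    + unfold unit_at_1; simpl Nat.eqb. cbv iota. rewrite Rplus_0_l.
      replace x with ((x - 2) + 2) at 1 by ring. rewrite rpow_plus.
      apply Rmult_le_compat_r; [ exact H2 | ].
      apply exp_le_compat.
      assert (ln (INR 2) <= ln (INR (S (S n)))).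
      { apply ln_le; [ simpl; lra | apply le_INR; lia ]. }
      nra.
  - apply (ex_series_plus unit_at_1 (fun n => rpow (x - 2) 2 * rpow 2 n)); assumption.
Qed.

Lemma rzeta_near_1 e : 0 < e -> exists x, 2 <= x /\ rzeta x < 1 + e.
Proof.
  intros He. pose proof (rzeta_pos 2 ltac:(lra)) as HK.
  assert (Hln : 0 < ln 2) by (rewrite <- ln_1; apply ln_increasing; lra).
  set (v := rzeta 2 / e). assert (Hv : 0 < v) by (apply Rdiv_lt_0_compat; lra).
  (* Chosen so that [2^{-(x-2)} = exp (- v)], which is at most [1 / (1 + v)]. *)
  exists (2 + v / ln 2).
  assert (0 < v / ln 2) by (apply Rdiv_lt_0_compat; lra).
  split; [ lra | ].
  eapply Rle_lt_trans; [ apply rzeta_upper; lra | ].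
  apply Rplus_lt_compat_l.
  replace (rpow (2 + v / ln 2 - 2) 2) with (/ exp v).
  2:{ unfold rpow. rewrite <- exp_Ropp. f_equal. replace (INR 2) with 2 by (simpl; ring).
      field. lra. }
  apply Rmult_lt_reg_l with (exp v); [ apply exp_pos | ].
  rewrite <- Rmult_assoc, Rinv_r, Rmult_1_l by (apply Rgt_not_eq, exp_pos).
  pose proof (exp_ineq1_le v).
  apply Rlt_le_trans with ((1 + v) * e); [ | apply Rmult_le_compat_r; lra ].
  rewrite Rmult_plus_distr_r. replace (v * e) with (rzeta 2) by (unfold v; field; lra). lra.
Qed.

Lemma rzeta_large M : exists x, 1 < x <= 2 /\ M < rzeta x.
Proof.
  set (d := / (2 * (1 + Rabs M))). pose proof (Rabs_pos M) as HM.
  assert (Hd : 0 < d <= 1).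
  { unfold d. split; [ apply Rinv_0_lt_compat; lra | ].
    rewrite <- Rinv_1. apply Rinv_le_contravar; lra. }
  exists (1 + d). split; [ lra | ].
  pose proof (rzeta_lower d ltac:(lra)) as H.
  replace (/ (2 * d)) with (1 + Rabs M) in H by (unfold d; field; lra).
  pose proof (Rle_abs M). lra.
Qed.

Lemma rzeta_surj a : 1 < a -> exists x, 1 < x /\ rzeta x = a.
Proof.
  intros Ha. destruct (rzeta_large a) as [x1 [Hx1 H1]].
  destruct (rzeta_near_1 (a - 1)) as [x2 [Hx2 H2]]; [ lra | ].
  assert (H12 : x1 < x2).
  { destruct (Rlt_or_le x1 x2) as [ H | H ]; [ exact H | ].
    replace x1 with x2 in H1 by lra. lra. }
  destruct (IVT_interv (fun x => a - rzeta x) x1 x2) as [z [Hz Ez]].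
  - intros c Hc. apply continuity_pt_minus;
      [ apply continuity_pt_const; intros ? ?; reflexivity | apply rzeta_continuous; lra ].
  - exact H12.
  - lra.
  - lra.
  - exists z. split; lra.
Qed.

Lemma lseries_surj a : 0 < a -> a < 1 -> exists x, 1 < x /\ lseries x = a.
Proof.
  intros Ha0 Ha1. destruct (rzeta_large (rzeta 2 / a)) as [x1 [Hx1 H1]].
  destruct (rzeta_near_1 ((1 - a) / 2)) as [x2 [Hx2 H2]]; [ lra | ].
  (* Clearing the denominator reduces the intermediate value argument to continuity of [rzeta]. [h]
     is negative at [x1], where [rzeta] is huge, and positive at [x2], where both zeta values are
     close to 1. *)
  set (h := fun x => rzeta (2 * x) - a * rzeta x).
  assert (Hh1 : h x1 < 0).
  { unfold h. pose proof (rzeta_decr 2 (2 * x1) ltac:(lra) ltac:(lra)).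
    apply (Rmult_lt_compat_l a) in H1; [ | exact Ha0 ].
    replace (a * (rzeta 2 / a)) with (rzeta 2) in H1 by (field; lra). lra. }
  assert (Hh2 : 0 < h x2).
  { unfold h. pose proof (rzeta_ge1 (2 * x2) ltac:(lra)). nra. }
  assert (H12 : x1 < x2).
  { destruct (Rlt_or_le x1 x2) as [ H | H ]; [ exact H | ].
    replace x1 with x2 in Hh1 by lra. lra. }
  destruct (IVT_interv h x1 x2) as [z [Hz Ez]]; try assumption.
  - intros c Hc. apply continuity_pt_minus.
    + apply (continuity_pt_comp (fun x => 2 * x) rzeta).
      * apply continuity_pt_scal, derivable_continuous_pt, derivable_pt_id.
      * apply rzeta_continuous; lra.
    + apply continuity_pt_scal, rzeta_continuous; lra.
  - exists z. split; [ lra | ]. unfold h in Ez.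
    pose proof (rzeta_pos z ltac:(lra)). rewrite <- lseries_rzeta in Ez by lra.
    apply Rmult_eq_reg_r with (rzeta z); lra.
Qed.

Lemma lseries_incr x y : 1 < x -> x < y -> lseries x < lseries y.
Proof.
  intros Hx Hxy. pose proof (lseries_growth x y Hx ltac:(lra)) as H.
  pose proof (rpow_2_lt x y Hxy). pose proof (rpow_ge0 y 2).
  pose proof (lseries_pos x Hx). nra.
Qed.

(** * Upper bound on vertical lines and determination of the supremum *)

Lemma Cmod_zeta_le s : 1 < Re s -> Cmod (zeta s) <= rzeta (Re s).
Proof.
  intros Hs. rewrite zeta_CSeries by exact Hs.
  apply Cmod_CSeries_le; [ | apply ex_series_rpow, Hs ].
  intro n. rewrite Cmod_cpow. lra.
Qed.

Lemma zeta_ratio x : 1 < x -> (zeta (RtoC (2 * x)) / zeta (RtoC x))%C = RtoC (lseries x).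
Proof.
  intros Hx. pose proof (rzeta_pos x Hx).
  rewrite !zeta_RtoC, <- lseries_rzeta, RtoC_mult by lra. field.
  intro E. apply RtoC_inj in E. lra.
Qed.

Lemma Re_line sigma t : Re (RtoC sigma + Ci * RtoC t) = sigma.
Proof. unfold Re; simpl. ring. Qed.

Theorem theorem3p1 (a : R) (ha0 : 0 < a) (ha1 : a <> 1) :
  (1 < a ->
     exists sigma : R,
       unique (fun x : R => 1 < x /\ zeta (RtoC x) = RtoC a) sigma /\
       sigma_sup a = Finite sigma) /\
  (a < 1 ->
     exists sigma : R,
       unique (fun x : R =>
         1 < x /\ (zeta (RtoC (2 * x)) / zeta (RtoC x))%C = RtoC a) sigma /\
       sigma_sup a = Finite sigma).
Proof.
  split; intros Ha.
  - destruct (rzeta_surj a Ha) as [x [Hx E]]. exists x. split; [ split | ].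
    + split; [ exact Hx | ]. rewrite zeta_RtoC, E by exact Hx. reflexivity.
    + intros y [Hy Ey]. rewrite zeta_RtoC in Ey by exact Hy. apply RtoC_inj in Ey.
      destruct (Rtotal_order x y) as [ H | [ H | H ] ]; [ exfalso | exact H | exfalso ].
      * pose proof (rzeta_decr x y Hx H). lra.
      * pose proof (rzeta_decr y x Hy H). lra.
    + apply is_lub_Rbar_unique. split.
      * intros y [t [_ Et]]. simpl. apply Rnot_lt_le. intro Hxy.
        pose proof (Cmod_zeta_le (RtoC y + Ci * RtoC t)) as H.
        rewrite Et, Re_line, Cmod_R, Rabs_pos_eq in H by lra.
        pose proof (rzeta_decr x y Hx Hxy). specialize (H ltac:(lra)). lra.
      * intros b Hb. apply Hb. exists 0.
        replace (RtoC x + Ci * RtoC 0)%C with (RtoC x) by ring. split.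
        -- intro E'. apply RtoC_inj in E'. lra.
        -- rewrite zeta_RtoC, E by exact Hx. reflexivity.
  - destruct (lseries_surj a ha0 Ha) as [x [Hx E]]. exists x. split; [ split | ].
    + split; [ exact Hx | ]. rewrite zeta_ratio, E by exact Hx. reflexivity.
    + intros y [Hy Ey]. rewrite zeta_ratio in Ey by exact Hy. apply RtoC_inj in Ey.
      destruct (Rtotal_order x y) as [ H | [ H | H ] ]; [ exfalso | exact H | exfalso ].
      * pose proof (lseries_incr x y Hx H). lra.
      * pose proof (lseries_incr y x Hy H). lra.
    + apply is_lub_Rbar_unique. split.
      * intros y [t [_ Et]]. simpl. apply Rnot_lt_le. intro Hxy.
        pose proof (Cmod_zeta_ge (RtoC y + Ci * RtoC t)) as H.
        rewrite Et, Re_line, Cmod_R, Rabs_pos_eq in H by lra.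
        pose proof (lseries_incr x y Hx Hxy). specialize (H ltac:(lra)). lra.
      * intros b Hb.
        (* An upper bound [b] dominates abscissas of solutions arbitrarily close to [x], hence [x]
           itself. *)
        assert (Happ : forall eta, 0 < eta -> exists y, x - eta < y /\ Rbar_le y b).
        { intros eta Heta. destruct (zeta_attains_near x eta Hx Heta) as [s [H1 [H2 Es]]].
          exists (Re s). split; [ exact H2 | ]. apply Hb. exists (Im s).
          replace (RtoC (Re s) + Ci * RtoC (Im s))%C with s
            by (destruct s; unfold Cplus, Cmult, RtoC, Ci, Re, Im; simpl; f_equal; ring).
          split; [ | rewrite Es, E; reflexivity ].
          intros ->. unfold Re in H1; simpl in H1. lra. }
        destruct b as [ b | | ].
        -- simpl. apply Rnot_lt_le. intro Hlt.
           destruct (Happ (x - b)) as [y [Hy Hyb]]; [ lra | ]. simpl in Hyb. lra.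
        -- exact I.
        -- destruct (Happ 1) as [y [_ []]]. lra.
Qed.
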